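(* Let $\sigma(t)$ (nowhere zero), $\kappa(t)$, $\mu(t)$, $\lambda(t)$ be smooth functions on an open time interval, and put $q(t)=\kappa(t)$, $p(t)=\kappa(t)\big(\mu(t)-\lambda(t)\big)$. Then the time-dependent one-factor model $$\tfrac12\sigma^{2}(t)\,(F_{xx}-F_{x})+\big(p(t)-x\,q(t)\big)F_{x}-F_{t}=0,\qquad F=F(t,x),$$ is maximally symmetric: its Lie algebra of Lie point symmetries is $\{sl(2,\mathbb{R})\oplus_{s}W_{3}\}\oplus_{s}\infty A_{1}$, and the equation is related to the classical heat equation by means of a point transformation.
   Context: A Lie point symmetry is a vector field $X=\xi^{t}\partial_t+\xi^{x}\partial_x+\eta\,\partial_F$, with coefficients functions of $(t,x,F)$, whose second prolongation annihilates the equation on its solution set. A point transformation is an invertible change of the variables $(t,x,F)$. $W_{3}$ is the three-dimensional Heisenberg–Weyl algebra, $\oplus_s$ denotes semidirect sum, and $\infty A_{1}$ is the infinite-dimensional abelian algebra of solution symmetries $b(t,x)\partial_F$, where $b$ is any solution of the equation. ''Maximally symmetric'' means admitting $5+1+\infty$ Lie point symmetries (five symmetries plus the homogeneous symmetry $F\partial_F$, together spanning $sl(2,\mathbb{R})\oplus_s W_3$, plus the solution symmetries), as for the heat equation. The variable $x=\log S$ is the logarithm of the stock price. *)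

(* Defs.v *)
From Stdlib Require Import Reals.
From Coquelicot Require Import Coquelicot.

Open Scope R_scope.

Definition interval (a b : Rbar) (t : R) : Prop := Rbar_lt a t /\ Rbar_lt t b.

Definition smooth1 (I : R -> Prop) (f : R -> R) : Prop :=
  forall t, I t -> forall n, ex_derive_n f n t.

Definition dt2 (f : R -> R -> R) (t x : R) : R := Derive (fun s => f s x) t.
Definition dx2 (f : R -> R -> R) (t x : R) : R := Derive (fun y => f t y) x.

Definition dt3 (f : R -> R -> R -> R) (t x F : R) : R := Derive (fun s => f s x F) t.
Definition dx3 (f : R -> R -> R -> R) (t x F : R) : R := Derive (fun y => f t y F) x.
Definition dF3 (f : R -> R -> R -> R) (t x F : R) : R := Derive (fun v => f t x v) F.

(* Since [Derive] is total, existence of each partial derivative is required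
   explicitly before the derivative is used. *)
Fixpoint Ck2 (n : nat) (U : R -> R -> Prop) (f : R -> R -> R) : Prop :=
  (forall t x, U t x -> continuity_2d_pt f t x) /\
  match n with
  | O => True
  | S m =>
      (forall t x, U t x ->
         ex_derive (fun s => f s x) t /\ ex_derive (fun y => f t y) x) /\
      Ck2 m U (dt2 f) /\ Ck2 m U (dx2 f)
  end.

Fixpoint Ck3 (n : nat) (U : R -> R -> R -> Prop) (f : R -> R -> R -> R) : Prop :=
  (forall t x F, U t x F ->
     continuous (fun p : R * R * R => f (fst (fst p)) (snd (fst p)) (snd p)) (t, x, F)) /\
  match n with
  | O => True
  | S m =>
      (forall t x F, U t x F ->
         ex_derive (fun s => f s x F) t /\ ex_derive (fun y => f t y F) x /\
         ex_derive (fun v => f t x v) F) /\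
      Ck3 m U (dt3 f) /\ Ck3 m U (dx3 f) /\ Ck3 m U (dF3 f)
  end.

Definition smooth2 (U : R -> R -> Prop) (f : R -> R -> R) : Prop :=
  forall n, Ck2 n U f.

(* Smoothness on the slab I x R x R of (t, x, F)-space. *)
Definition smooth3 (I : R -> Prop) (f : R -> R -> R -> R) : Prop :=
  forall n, Ck3 n (fun t _ _ => I t) f.

Inductive coord : Set := ct | cx | cF | cFt | cFx | cFtt | cFtx | cFxx.

Definition coord_eq_dec (c d : coord) : {c = d} + {c <> d}.
Proof. decide equality. Defined.

Definition jet : Type := coord -> R.

Definition upd (j : jet) (c : coord) (s : R) : jet :=
  fun d => if coord_eq_dec d c then s else j d.

Definition pd (c : coord) (f : jet -> R) (j : jet) : R :=
  Derive (fun s => f (upd j c s)) (j c).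

Definition jet_of (f : R -> R -> R) (t x : R) : jet := fun c =>
  match c with
  | ct => t
  | cx => x
  | cF => f t x
  | cFt => dt2 f t x
  | cFx => dx2 f t x
  | cFtt => dt2 (dt2 f) t x
  | cFtx => dt2 (dx2 f) t x
  | cFxx => dx2 (dx2 f) t x
  end.

(* A map [E : jet -> R] stands for the equation E = 0. *)
Definition solves (U : R -> R -> Prop) (E : jet -> R) (f : R -> R -> R) : Prop :=
  forall t x, U t x -> E (jet_of f t x) = 0.

Definition solution (I : R -> Prop) (E : jet -> R) (b : R -> R -> R) : Prop :=
  smooth2 (fun t _ => I t) b /\ solves (fun t _ => I t) E b.

Definition one_factor_model (sigma p q : R -> R) (j : jet) : R :=
  / 2 * sigma (j ct) ^ 2 * (j cFxx - j cFx)
  + (p (j ct) - j cx * q (j ct)) * j cFx - j cFt.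

Definition heat_equation (j : jet) : R := j cFxx - j cFt.

Record vfield : Type := VField {
  xi_t : R -> R -> R -> R;
  xi_x : R -> R -> R -> R;
  eta  : R -> R -> R -> R
}.

Definition vf_smooth (I : R -> Prop) (X : vfield) : Prop :=
  smooth3 I (xi_t X) /\ smooth3 I (xi_x X) /\ smooth3 I (eta X).

(* Fields are identified when they agree on I x R x R. *)
Definition vf_eq (I : R -> Prop) (X Y : vfield) : Prop :=
  forall t x F, I t ->
    xi_t X t x F = xi_t Y t x F /\
    xi_x X t x F = xi_x Y t x F /\
    eta X t x F = eta Y t x F.

Definition vf_zero : vfield :=
  VField (fun _ _ _ => 0) (fun _ _ _ => 0) (fun _ _ _ => 0).

Definition vf_add (X Y : vfield) : vfield :=
  VField (fun t x F => xi_t X t x F + xi_t Y t x F)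
         (fun t x F => xi_x X t x F + xi_x Y t x F)
         (fun t x F => eta X t x F + eta Y t x F).

Definition vf_scal (k : R) (X : vfield) : vfield :=
  VField (fun t x F => k * xi_t X t x F)
         (fun t x F => k * xi_x X t x F)
         (fun t x F => k * eta X t x F).

Definition vf_app (X : vfield) (f : R -> R -> R -> R) (t x F : R) : R :=
  xi_t X t x F * dt3 f t x F + xi_x X t x F * dx3 f t x F + eta X t x F * dF3 f t x F.

Definition vf_bracket (X Y : vfield) : vfield :=
  VField (fun t x F => vf_app X (xi_t Y) t x F - vf_app Y (xi_t X) t x F)
         (fun t x F => vf_app X (xi_x Y) t x F - vf_app Y (xi_x X) t x F)
         (fun t x F => vf_app X (eta Y) t x F - vf_app Y (eta X) t x F).

Definition lift (f : R -> R -> R -> R) (j : jet) : R := f (j ct) (j cx) (j cF).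

(* Total derivatives; applied only to functions on the first jet space, so the
   terms that would involve third-order derivatives of F are absent. *)
Definition total_t (f : jet -> R) (j : jet) : R :=
  pd ct f j + j cFt * pd cF f j + j cFtt * pd cFt f j + j cFtx * pd cFx f j.
Definition total_x (f : jet -> R) (j : jet) : R :=
  pd cx f j + j cFx * pd cF f j + j cFtx * pd cFt f j + j cFxx * pd cFx f j.

Definition eta_t (X : vfield) (j : jet) : R :=
  total_t (lift (eta X)) j
  - j cFt * total_t (lift (xi_t X)) j - j cFx * total_t (lift (xi_x X)) j.
Definition eta_x (X : vfield) (j : jet) : R :=
  total_x (lift (eta X)) j
  - j cFt * total_x (lift (xi_t X)) j - j cFx * total_x (lift (xi_x X)) j.
Definition eta_tt (X : vfield) (j : jet) : R :=
  total_t (eta_t X) j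
  - j cFtt * total_t (lift (xi_t X)) j - j cFtx * total_t (lift (xi_x X)) j.
Definition eta_tx (X : vfield) (j : jet) : R :=
  total_t (eta_x X) j
  - j cFtx * total_t (lift (xi_t X)) j - j cFxx * total_t (lift (xi_x X)) j.
Definition eta_xx (X : vfield) (j : jet) : R :=
  total_x (eta_x X) j
  - j cFtx * total_x (lift (xi_t X)) j - j cFxx * total_x (lift (xi_x X)) j.

Definition prolongation2 (X : vfield) (E : jet -> R) (j : jet) : R :=
  lift (xi_t X) j * pd ct E j + lift (xi_x X) j * pd cx E j + lift (eta X) j * pd cF E j
  + eta_t X j * pd cFt E j + eta_x X j * pd cFx E j
  + eta_tt X j * pd cFtt E j + eta_tx X j * pd cFtx E j + eta_xx X j * pd cFxx E j.

Definition lie_symmetry (I : R -> Prop) (E : jet -> R) (X : vfield) : Prop :=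
  vf_smooth I X /\
  forall j : jet, I (j ct) -> E j = 0 -> prolongation2 X E j = 0.

Definition solution_field (b : R -> R -> R) : vfield :=
  VField (fun _ _ _ => 0) (fun _ _ _ => 0) (fun t x _ => b t x).

Definition homogeneous_field : vfield :=
  VField (fun _ _ _ => 0) (fun _ _ _ => 0) (fun _ _ F => F).

(* sl2, W3 and sl2W3 carry Coquelicot's product module structures. *)

(* (a, b, c) is the traceless matrix [[a, b], [c, -a]]; the bracket is the
   matrix commutator. *)
Definition sl2 : Type := (R * R * R)%type.
Definition sl2_bracket (A B : sl2) : sl2 :=
  let '(a, b, c) := A in
  let '(a', b', c') := B in
  (b * c' - b' * c, 2 * (a * b' - a' * b), 2 * (c * a' - c' * a)).

(* (u, v, z) = u P + v Q + z Z with [P, Q] = Z and Z central. *)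
Definition W3 : Type := (R * R * R)%type.
Definition W3_bracket (w w' : W3) : W3 :=
  let '(u, v, _) := w in
  let '(u', v', _) := w' in
  (0, 0, u * v' - u' * v).

(* sl(2,R) acts on (u, v) by the defining representation and kills Z. *)
Definition sl2_act (A : sl2) (w : W3) : W3 :=
  let '(a, b, c) := A in
  let '(u, v, _) := w in
  (a * u + b * v, c * u - a * v, 0).

Definition sl2W3 : Type := (sl2 * W3)%type.
Definition sl2W3_bracket (g h : sl2W3) : sl2W3 :=
  let '(A, w) := g in
  let '(B, w') := h in
  (sl2_bracket A B,
   minus (plus (W3_bracket w w') (sl2_act A w')) (sl2_act B w)).

Definition sl2W3_Z : sl2W3 := ((0, 0, 0), (0, 0, 1)).

Definition infinite_dimensional_solutions (I : R -> Prop) (E : jet -> R) : Prop :=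
  forall n : nat, exists B : nat -> R -> R -> R,
    (forall i, (i <= n)%nat -> solution I E (B i)) /\
    (forall c : nat -> R,
       (forall t x, I t -> sum_n (fun i => c i * B i t x) n = 0) ->
       forall i, (i <= n)%nat -> c i = 0).

(* The symmetry algebra is the internal semidirect sum of the subalgebra
   phi(sl2W3) and the abelian ideal of solution fields. *)
Definition maximally_symmetric (I : R -> Prop) (E : jet -> R) : Prop :=
  exists phi : sl2W3 -> vfield,
    (forall (k : R) (g h : sl2W3),
       vf_eq I (phi (plus (scal k g) h)) (vf_add (vf_scal k (phi g)) (phi h))) /\
    (forall g h : sl2W3,
       vf_eq I (phi (sl2W3_bracket g h)) (vf_bracket (phi g) (phi h))) /\
    vf_eq I (phi sl2W3_Z) homogeneous_field /\
    (forall X : vfield, lie_symmetry I E X <->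
       exists (g : sl2W3) (b : R -> R -> R),
         solution I E b /\ vf_eq I X (vf_add (phi g) (solution_field b))) /\
    (forall (g : sl2W3) (b : R -> R -> R),
       solution I E b -> vf_eq I (phi g) (solution_field b) -> g = zero) /\
    (forall (X : vfield) (b : R -> R -> R), lie_symmetry I E X -> solution I E b ->
       exists b', solution I E b' /\
         vf_eq I (vf_bracket X (solution_field b)) (solution_field b')) /\
    (forall b b' : R -> R -> R, solution I E b -> solution I E b' ->
       vf_eq I (vf_bracket (solution_field b) (solution_field b')) vf_zero) /\
    infinite_dimensional_solutions I E.

Definition map_smooth (I : R -> Prop) (Phi : R * R * R -> R * R * R) : Prop :=
  smooth3 I (fun t x F => fst (fst (Phi (t, x, F)))) /\
  smooth3 I (fun t x F => snd (fst (Phi (t, x, F)))) /\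
  smooth3 I (fun t x F => snd (Phi (t, x, F))).

Definition point_transformation (I J : R -> Prop) (Phi Psi : R * R * R -> R * R * R) : Prop :=
  map_smooth I Phi /\ map_smooth J Psi /\
  (forall p, I (fst (fst p)) -> J (fst (fst (Phi p))) /\ Psi (Phi p) = p) /\
  (forall p, J (fst (fst p)) -> I (fst (fst (Psi p))) /\ Phi (Psi p) = p).

(* Phi maps the graph of f over U onto the graph of u over V. *)
Definition maps_graph (Phi : R * R * R -> R * R * R)
    (U : R -> R -> Prop) (f : R -> R -> R) (V : R -> R -> Prop) (u : R -> R -> R) : Prop :=
  (forall t x, U t x -> exists s y, V s y /\ Phi (t, x, f t x) = (s, y, u s y)) /\
  (forall s y, V s y -> exists t x, U t x /\ Phi (t, x, f t x) = (s, y, u s y)).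

Definition open2 (U : R -> R -> Prop) : Prop :=
  open (fun p : R * R => U (fst p) (snd p)).

(* A point transformation may mix dependent and independent variables, so the
   correspondence of solutions is stated for functions on open subsets. *)
Definition transforms (I J : R -> Prop) (Phi : R * R * R -> R * R * R)
    (E E' : jet -> R) : Prop :=
  forall (U V : R -> R -> Prop) (f u : R -> R -> R),
    open2 U -> (forall t x, U t x -> I t) ->
    open2 V -> (forall s y, V s y -> J s) ->
    smooth2 U f -> smooth2 V u ->
    maps_graph Phi U f V u ->
    (solves U E f <-> solves V E' u).

Definition point_equivalent_to_heat (I : R -> Prop) (E : jet -> R) : Prop :=
  exists (c d : Rbar) (Phi Psi : R * R * R -> R * R * R),
    Rbar_lt c d /\
    point_transformation I (interval c d) Phi Psi /\
    transforms I (interval c d) Phi E heat_equation.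

(* Main.v *)
(** With [A = sigma^2 / 2], let [rho], [beta], [s] solve [rho' = - q rho], [beta' = (p - A) rho] and
    [s' = A rho^2].  Then [F (t, x) = u (s, rho x + beta)] satisfies the model if and only if
    [u_s = u_yy]; since [s' > 0] the map is invertible, which gives the point transformation.
    Any symmetry has [xi_t = tau (t)], [xi_x] affine in [x], and [eta = f F + g] with [g] a solution.
    In the coordinates [s], [y = rho x + beta] the determining equations for [(tau, xi_x, f)] integrate
    explicitly: [xi^s] is a quadratic polynomial in [s], [xi^y = (xi^s)' y / 2 + g0 + g1 s], and [f] is
    then fixed up to a constant.  These six parameters are those of [sl(2,R)] and [W_3].  The
    solutions [exp (k y + k^2 s)], [k = 0, 1, 2, ...], are linearly independent. *)

Require Import Defs.
From Stdlib Require Import Reals Lra Lia.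
From Coquelicot Require Import Coquelicot.
Open Scope R_scope.

(** * Smooth functions on a slab *)

(** The equations for [rho], [beta], [s] are the chain rule for F = u (s, y), y = rho x + beta, read
    backwards. With D = p - A - x q, the coefficient of u_y is rho D - rho' x - beta'; it vanishes
    for all x exactly when rho' = - q rho and beta' = (p - A) rho, and what remains is A rho^2 u_yy
    = s' u_s. The system is triangular, so primitives and one exponential solve it on the whole
    interval. As the model has no term in F itself, the dependent variable can stay unchanged.

    The symmetry algebra is not transported through the point transformation. The heat fields are
    pulled back to explicit formulas in t and x, so that brackets and determining equations become
    rational identities between values at a single time; only completeness needs integration in t.

    Two constraints shape the details: [Derive] is total, so a formula for a derivative is first
    proved as [is_derive]; and equalities are known only for times in the interval, so
    differentiating them in t uses openness. *)

Definition open1 (I : R -> Prop) : Prop := forall t, I t -> locally t I.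

Lemma open1_interval (a b : Rbar) : open1 (interval a b).
Proof.
  intros t [H1 H2].
  apply (locally_interval _ t a b H1 H2).
  intros y Ha Hb; split; assumption.
Qed.

Lemma open1_ext_loc {T : Type} (I : R -> Prop) (f g : R -> T) (t : R) :
  open1 I -> (forall s, I s -> f s = g s) -> I t -> locally t (fun s => f s = g s).
Proof.
  intros HI E Ht; generalize (HI t Ht); apply filter_imp; auto.
Qed.

Lemma slab_locally (I : R -> Prop) (t x F : R) : open1 I -> I t ->
  locally ((t, x, F) : R * R * R) (fun p => I (fst (fst p))).
Proof.
  intros HI Ht.
  destruct (HI t Ht) as [eps He].
  exists eps; intros [[t' x'] F'] [[H _] _]; apply He; exact H.
Qed.

Notation slab I := (fun t (_ _ : R) => I t).

Lemma Ck3_continuous (U : R -> R -> R -> Prop) n f : Ck3 n U f -> forall t x F, U t x F ->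
  continuous (fun p : R * R * R => f (fst (fst p)) (snd (fst p)) (snd p)) (t, x, F).
Proof. destruct n; intros [H _]; exact H. Qed.

Lemma Ck3_pred (U : R -> R -> R -> Prop) n : forall f, Ck3 (S n) U f -> Ck3 n U f.
Proof.
  induction n as [|n IH]; intros f H.
  - split; [exact (proj1 H) | exact I].
  - destruct H as [Hc [He [Ht [Hx HF]]]].
    split; [exact Hc|]. split; [exact He|].
    repeat split; apply IH; assumption.
Qed.

Lemma Ck3_ext (I : R -> Prop) n : open1 I -> forall f g,
  (forall t x F, I t -> f t x F = g t x F) ->
  Ck3 n (slab I) f -> Ck3 n (slab I) g.
Proof.
  intros HI; induction n as [|n IH]; intros f g E H.
  - split; [|exact Logic.I].
    intros t x F Ht.
    apply continuous_ext_loc with (2 := proj1 H t x F Ht).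
    generalize (slab_locally I t x F HI Ht); apply filter_imp; intros p Hp; apply E; exact Hp.
  - destruct H as [Hc [He [Ht [Hx HF]]]].
    split; [|split].
    + intros t x F It.
      apply continuous_ext_loc with (2 := Hc t x F It).
      generalize (slab_locally I t x F HI It); apply filter_imp; intros p Hp; apply E; exact Hp.
    + intros t x F It; destruct (He t x F It) as [E1 [E2 E3]].
      split; [|split].
      (* Only the t-derivative needs openness of [I]: along x and F the two functions agree on whole
         lines. *)
      * apply ex_derive_ext_loc with (2 := E1).
        apply (open1_ext_loc I _ _ t HI); auto.
      * apply ex_derive_ext with (2 := E2); auto.
      * apply ex_derive_ext with (2 := E3); auto.
    + repeat split.
      * apply IH with (2 := Ht); intros t x F It; unfold dt3; apply Derive_ext_loc.
        apply (open1_ext_loc I _ _ t HI); auto.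
      * apply IH with (2 := Hx); intros t x F It; unfold dx3; apply Derive_ext; auto.
      * apply IH with (2 := HF); intros t x F It; unfold dF3; apply Derive_ext; auto.
Qed.

(** Lets explicit formulas replace the [Derive] terms inside [Ck3]. The closure rules below are
    inductions on the order, run on such formulas. *)
Lemma Ck3_intro (I : R -> Prop) n f ft fx fF : open1 I ->
  (forall t x F, I t ->
    continuous (fun p : R * R * R => f (fst (fst p)) (snd (fst p)) (snd p)) (t, x, F)) ->
  (forall t x F, I t -> is_derive (fun s => f s x F) t (ft t x F) /\
     is_derive (fun y => f t y F) x (fx t x F) /\ is_derive (fun v => f t x v) F (fF t x F)) ->
  Ck3 n (slab I) ft -> Ck3 n (slab I) fx -> Ck3 n (slab I) fF -> Ck3 (S n) (slab I) f.
Proof.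
  intros HI Hc Hd H1 H2 H3.
  split; [exact Hc|]. split.
  - intros t x F It; destruct (Hd t x F It) as [E1 [E2 E3]].
    split; [|split]; eexists; eassumption.
  - split; [apply (Ck3_ext I n HI ft) | split; [apply (Ck3_ext I n HI fx) | apply (Ck3_ext I n HI fF)]];
      try assumption; intros t x F It; destruct (Hd t x F It) as [E1 [E2 E3]]; symmetry; apply is_derive_unique; assumption.
Qed.

Lemma Ck3_const (I : R -> Prop) n c : open1 I -> Ck3 n (slab I) (fun _ _ _ => c).
Proof.
  intros HI; revert c; induction n as [|n IH]; intros c.
  - split; [|exact Logic.I]. intros; apply continuous_const.
  - apply Ck3_intro with (ft := fun _ _ _ => 0) (fx := fun _ _ _ => 0) (fF := fun _ _ _ => 0); auto.
    + intros; apply continuous_const.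
    + intros; split; [|split]; apply @is_derive_const.
Qed.

Lemma Ck3_x (I : R -> Prop) n : open1 I -> Ck3 n (slab I) (fun _ x _ => x).
Proof.
  intros HI.
  assert (Hc : forall t x F, I t -> continuous (fun p : R * R * R => snd (fst p)) (t, x, F)).
  { intros t x F _. apply (continuous_comp (fun p : R * R * R => fst p) (fun q => snd q)).
    apply continuous_fst. apply continuous_snd. }
  destruct n.
  - split; [exact Hc|exact Logic.I].
  - apply Ck3_intro with (ft := fun _ _ _ => 0) (fx := fun _ _ _ => 1) (fF := fun _ _ _ => 0); auto;
      try apply Ck3_const; auto.
    intros; split; [|split]; try apply @is_derive_const. apply @is_derive_id.
Qed.

Lemma Ck3_F (I : R -> Prop) n : open1 I -> Ck3 n (slab I) (fun _ _ F => F).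
Proof.
  intros HI.
  assert (Hc : forall t x F, I t -> continuous (fun p : R * R * R => snd p) (t, x, F)).
  { intros t x F _. apply continuous_snd. }
  destruct n.
  - split; [exact Hc|exact Logic.I].
  - apply Ck3_intro with (ft := fun _ _ _ => 0) (fx := fun _ _ _ => 0) (fF := fun _ _ _ => 1); auto;
      try apply Ck3_const; auto.
    intros; split; [|split]; try apply @is_derive_const. apply @is_derive_id.
Qed.

Lemma Ck3_plus (I : R -> Prop) n : open1 I -> forall f g,
  Ck3 n (slab I) f -> Ck3 n (slab I) g -> Ck3 n (slab I) (fun t x F => f t x F + g t x F).
Proof.
  intros HI; induction n as [|n IH]; intros f g Hf Hg.
  - split; [|exact Logic.I]. intros t x F It.
    apply (continuous_plus (V := R_NormedModule)); [apply Hf|apply Hg]; exact It.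
  - destruct Hf as [Hc [He [Ht [Hx HF]]]]. destruct Hg as [Gc [Ge [Gt [Gx GF]]]].
    apply Ck3_intro with (ft := fun t x F => dt3 f t x F + dt3 g t x F)
      (fx := fun t x F => dx3 f t x F + dx3 g t x F) (fF := fun t x F => dF3 f t x F + dF3 g t x F); auto.
    + intros t x F It.
      apply (continuous_plus (V := R_NormedModule)); [apply Hc|apply Gc]; exact It.
    + intros t x F It; destruct (He t x F It) as [E1 [E2 E3]]; destruct (Ge t x F It) as [D1 [D2 D3]].
      unfold dt3, dx3, dF3.
      split; [|split]; apply (is_derive_plus (V := R_NormedModule)); apply Derive_correct; assumption.
Qed.

Lemma Ck3_mult (I : R -> Prop) n : open1 I -> forall f g,
  Ck3 n (slab I) f -> Ck3 n (slab I) g -> Ck3 n (slab I) (fun t x F => f t x F * g t x F).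
Proof.
  intros HI; induction n as [|n IH]; intros f g Hf Hg.
  - split; [|exact Logic.I]. intros t x F It.
    apply (continuous_mult (K := R_AbsRing)); [apply Hf|apply Hg]; exact It.
  - assert (Hf' := Ck3_pred _ _ _ Hf). assert (Hg' := Ck3_pred _ _ _ Hg).
    destruct Hf as [Hc [He [Ht [Hx HF]]]]. destruct Hg as [Gc [Ge [Gt [Gx GF]]]].
    apply Ck3_intro with (ft := fun t x F => dt3 f t x F * g t x F + f t x F * dt3 g t x F)
      (fx := fun t x F => dx3 f t x F * g t x F + f t x F * dx3 g t x F)
      (fF := fun t x F => dF3 f t x F * g t x F + f t x F * dF3 g t x F); auto.
    + intros t x F It.
      apply (continuous_mult (K := R_AbsRing)); [apply Hc|apply Gc]; exact It.
    + intros t x F It; destruct (He t x F It) as [E1 [E2 E3]]; destruct (Ge t x F It) as [D1 [D2 D3]].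
      unfold dt3, dx3, dF3.
      split; [|split];
        [apply (is_derive_mult (K := R_AbsRing) (fun s => f s x F) (fun s => g s x F))
        |apply (is_derive_mult (K := R_AbsRing) (fun y => f t y F) (fun y => g t y F))
        |apply (is_derive_mult (K := R_AbsRing) (fun v => f t x v) (fun v => g t x v))];
        try (apply Derive_correct; assumption); exact Rmult_comm.
    + apply Ck3_plus; auto.
    + apply Ck3_plus; auto.
    + apply Ck3_plus; auto.
Qed.

(** The derivative is written as - f' times (1/f)(1/f), so the induction hypothesis for 1/f itself
    and the product rule give the next order. *)
Lemma Ck3_inv (I : R -> Prop) n f : open1 I -> (forall t x F, I t -> f t x F <> 0) ->
  Ck3 n (slab I) f -> Ck3 n (slab I) (fun t x F => / f t x F).
Proof.
  intros HI Hnz Hf.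
  assert (Hc : forall t x F, I t ->
    continuous (fun p : R * R * R => / f (fst (fst p)) (snd (fst p)) (snd p)) (t, x, F)).
  { intros t x F It.
    apply (continuous_comp (fun p : R * R * R => f (fst (fst p)) (snd (fst p)) (snd p)) Rinv).
    - apply (Ck3_continuous _ _ _ Hf); exact It.
    - apply continuous_Rinv, Hnz; exact It. }
  induction n as [|n IH].
  - split; [exact Hc|exact Logic.I].
  - assert (Hi := IH (Ck3_pred _ _ _ Hf)).
    destruct Hf as [_ [He [Ht [Hx HF]]]].
    apply Ck3_intro with (ft := fun t x F => (-1 * dt3 f t x F) * (/ f t x F * / f t x F))
      (fx := fun t x F => (-1 * dx3 f t x F) * (/ f t x F * / f t x F))
      (fF := fun t x F => (-1 * dF3 f t x F) * (/ f t x F * / f t x F)); auto.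
    + intros t x F It; destruct (He t x F It) as [E1 [E2 E3]]. assert (N := Hnz t x F It).
      unfold dt3, dx3, dF3.
      split; [|split]; (evar_last; [apply is_derive_inv; [apply Derive_correct; eassumption | exact N]|]);
        simpl; match goal with |- - ?D / _ = -1 * ?D' * _ => change D with D' end; field; exact N.
    + repeat apply Ck3_mult; auto; apply Ck3_const; auto.
    + repeat apply Ck3_mult; auto; apply Ck3_const; auto.
    + repeat apply Ck3_mult; auto; apply Ck3_const; auto.
Qed.

Lemma Ck3_exp (I : R -> Prop) n f : open1 I ->
  Ck3 n (slab I) f -> Ck3 n (slab I) (fun t x F => exp (f t x F)).
Proof.
  intros HI Hf.
  assert (Hc : forall t x F, I t ->
    continuous (fun p : R * R * R => exp (f (fst (fst p)) (snd (fst p)) (snd p))) (t, x, F)).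
  { intros t x F It.
    apply (continuous_comp (fun p : R * R * R => f (fst (fst p)) (snd (fst p)) (snd p)) exp).
    - apply (Ck3_continuous _ _ _ Hf); exact It.
    - apply continuous_exp. }
  induction n as [|n IH].
  - split; [exact Hc|exact Logic.I].
  - assert (Hi := IH (Ck3_pred _ _ _ Hf)).
    destruct Hf as [_ [He [Ht [Hx HF]]]].
    apply Ck3_intro with (ft := fun t x F => dt3 f t x F * exp (f t x F))
      (fx := fun t x F => dx3 f t x F * exp (f t x F))
      (fF := fun t x F => dF3 f t x F * exp (f t x F)); auto using Ck3_mult.
    intros t x F It; destruct (He t x F It) as [E1 [E2 E3]].
    unfold dt3, dx3, dF3.
    split; [|split]; (evar_last; [apply (is_derive_comp exp); [apply is_derive_exp|apply Derive_correct; eassumption]|]); reflexivity.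
Qed.

(** * Functions of time alone *)

Lemma Ck3_time_S (I : R -> Prop) n f g : open1 I -> (forall t, I t -> is_derive f t (g t)) ->
  Ck3 n (slab I) (fun t _ _ => g t) -> Ck3 (S n) (slab I) (fun t _ _ => f t).
Proof.
  intros HI Hd Hg.
  apply Ck3_intro with (ft := fun t _ _ => g t) (fx := fun _ _ _ => 0) (fF := fun _ _ _ => 0); auto.
  - intros t x F It.
    apply (continuous_comp (fun p : R * R * R => fst (fst p)) f).
    + apply (continuous_comp (fun p : R * R * R => fst p) (fun q => fst q));
        [apply continuous_fst|apply continuous_fst].
    + apply (ex_derive_continuous (V := R_NormedModule)); eexists; apply Hd; exact It.
  - intros t x F It; split; [apply Hd; exact It|split; apply @is_derive_const].
  - apply Ck3_const; exact HI.
  - apply Ck3_const; exact HI.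
Qed.

Notation smooth_time I f := (smooth3 I (fun t _ _ => f t)).

Lemma smooth3_ext (I : R -> Prop) f g : open1 I ->
  (forall t x F, I t -> f t x F = g t x F) -> smooth3 I f -> smooth3 I g.
Proof. intros HI E H n; apply (Ck3_ext I n HI f); auto. Qed.

Lemma smooth3_const (I : R -> Prop) c : open1 I -> smooth3 I (fun _ _ _ => c).
Proof. intros HI n; apply Ck3_const; exact HI. Qed.

Lemma smooth3_x (I : R -> Prop) : open1 I -> smooth3 I (fun _ x _ => x).
Proof. intros HI n; apply Ck3_x; exact HI. Qed.

Lemma smooth3_F (I : R -> Prop) : open1 I -> smooth3 I (fun _ _ F => F).
Proof. intros HI n; apply Ck3_F; exact HI. Qed.

Lemma smooth3_plus (I : R -> Prop) f g : open1 I -> smooth3 I f -> smooth3 I g ->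
  smooth3 I (fun t x F => f t x F + g t x F).
Proof. intros HI Hf Hg n; apply Ck3_plus; auto. Qed.

Lemma smooth3_mult (I : R -> Prop) f g : open1 I -> smooth3 I f -> smooth3 I g ->
  smooth3 I (fun t x F => f t x F * g t x F).
Proof. intros HI Hf Hg n; apply Ck3_mult; auto. Qed.

Lemma smooth3_opp (I : R -> Prop) f : open1 I -> smooth3 I f -> smooth3 I (fun t x F => - f t x F).
Proof.
  intros HI Hf; apply (smooth3_ext I (fun t x F => -1 * f t x F) _ HI); [intros; ring|].
  apply smooth3_mult; auto; apply smooth3_const; exact HI.
Qed.

Lemma smooth3_minus (I : R -> Prop) f g : open1 I -> smooth3 I f -> smooth3 I g ->
  smooth3 I (fun t x F => f t x F - g t x F).
Proof. intros HI Hf Hg; apply smooth3_plus; auto; apply smooth3_opp; auto. Qed.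

Lemma smooth3_inv (I : R -> Prop) f : open1 I -> (forall t x F, I t -> f t x F <> 0) ->
  smooth3 I f -> smooth3 I (fun t x F => / f t x F).
Proof. intros HI Hnz Hf n; apply Ck3_inv; auto. Qed.

Lemma smooth3_div (I : R -> Prop) f g : open1 I -> (forall t x F, I t -> g t x F <> 0) ->
  smooth3 I f -> smooth3 I g -> smooth3 I (fun t x F => f t x F / g t x F).
Proof. intros HI Hnz Hf Hg; apply smooth3_mult; auto; apply smooth3_inv; auto. Qed.

Lemma smooth3_exp (I : R -> Prop) f : open1 I -> smooth3 I f -> smooth3 I (fun t x F => exp (f t x F)).
Proof. intros HI Hf n; apply Ck3_exp; auto. Qed.

Lemma smooth3_pow (I : R -> Prop) f k : open1 I -> smooth3 I f -> smooth3 I (fun t x F => f t x F ^ k).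
Proof.
  intros HI Hf; induction k as [|k IH]; simpl; [apply smooth3_const; exact HI|].
  apply smooth3_mult; auto.
Qed.

Ltac smooth :=
  repeat first
  [ assumption
  | apply smooth3_const; assumption
  | apply smooth3_x; assumption
  | apply smooth3_F; assumption
  | apply smooth3_div; [assumption | | | ]
  | apply smooth3_minus; [assumption | | ]
  | apply smooth3_plus; [assumption | | ]
  | apply smooth3_opp; [assumption | ]
  | apply smooth3_pow; [assumption | ]
  | apply smooth3_exp; [assumption | ]
  | apply smooth3_mult; [assumption | | ] ].

Lemma smooth3_dt3 (I : R -> Prop) f : smooth3 I f -> smooth3 I (dt3 f).
Proof. intros H n; exact (proj1 (proj2 (proj2 (H (S n))))). Qed.

Lemma smooth3_dx3 (I : R -> Prop) f : smooth3 I f -> smooth3 I (dx3 f).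
Proof. intros H n; exact (proj1 (proj2 (proj2 (proj2 (H (S n)))))). Qed.

Lemma smooth3_dF3 (I : R -> Prop) f : smooth3 I f -> smooth3 I (dF3 f).
Proof. intros H n; exact (proj2 (proj2 (proj2 (proj2 (H (S n)))))). Qed.

Lemma smooth3_is_derive_t (I : R -> Prop) f t x F : smooth3 I f -> I t ->
  is_derive (fun s => f s x F) t (dt3 f t x F).
Proof. intros H It; exact (Derive_correct _ _ (proj1 (proj1 (proj2 (H 1%nat)) t x F It))). Qed.

Lemma smooth3_is_derive_x (I : R -> Prop) f t x F : smooth3 I f -> I t ->
  is_derive (fun y => f t y F) x (dx3 f t x F).
Proof. intros H It; exact (Derive_correct _ _ (proj1 (proj2 (proj1 (proj2 (H 1%nat)) t x F It)))). Qed.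

Lemma smooth3_is_derive_F (I : R -> Prop) f t x F : smooth3 I f -> I t ->
  is_derive (fun v => f t x v) F (dF3 f t x F).
Proof. intros H It; exact (Derive_correct _ _ (proj2 (proj2 (proj1 (proj2 (H 1%nat)) t x F It)))). Qed.

Lemma smooth_time_ex_derive (I : R -> Prop) f t : smooth_time I f -> I t -> ex_derive f t.
Proof. intros H It; eexists; apply (smooth3_is_derive_t I _ t 0 0 H It). Qed.

Lemma smooth_time_Derive (I : R -> Prop) f : smooth_time I f -> smooth_time I (Derive f).
Proof. intros H; exact (smooth3_dt3 I _ H). Qed.

Lemma smooth_time_primitive (I : R -> Prop) f g : open1 I ->
  (forall t, I t -> is_derive f t (g t)) -> smooth_time I g -> smooth_time I f.
Proof. intros HI Hd Hg n; apply Ck3_pred, (Ck3_time_S I n f g HI Hd), Hg. Qed.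

(** Bootstrap: if [f] is of class n, so is its derivative [g * f], hence [f] is of class n + 1.
    Differentiability gives the continuity that starts the induction. *)
Lemma smooth_time_linear_ode (I : R -> Prop) f g : open1 I ->
  (forall t, I t -> is_derive f t (g t * f t)) -> smooth_time I g -> smooth_time I f.
Proof.
  intros HI Hd Hg n; induction n as [|n IH].
  - split; [|exact Logic.I]. intros t x F It.
    apply (continuous_comp (fun p : R * R * R => fst (fst p)) f).
    + apply (continuous_comp (fun p : R * R * R => fst p) (fun q => fst q));
        apply continuous_fst.
    + apply (ex_derive_continuous (V := R_NormedModule)); eexists; apply Hd; exact It.
  - apply (Ck3_time_S I n f (fun t => g t * f t) HI Hd).
    apply (Ck3_mult I n HI (fun t _ _ => g t) (fun t _ _ => f t)); [apply Hg | exact IH].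
Qed.

Lemma smooth1_time (I : R -> Prop) f : open1 I -> smooth1 I f -> smooth_time I f.
Proof.
  intros HI H n; revert f H; induction n as [|n IH]; intros f H.
  - split; [|exact Logic.I]. intros t x F It.
    apply (continuous_comp (fun p : R * R * R => fst (fst p)) f).
    + apply (continuous_comp (fun p : R * R * R => fst p) (fun q => fst q));
        apply continuous_fst.
    + apply (ex_derive_continuous (V := R_NormedModule)), (H t It 1%nat).
  - apply (Ck3_time_S I n f (Derive f) HI).
    + intros t It; apply Derive_correct, (H t It 1%nat).
    (* [ex_derive_n] of order 0 is [True]; from order 1 on, the k-th derivative of [Derive f] is the
       derivative of order k + 1 of [f]. *)
    + apply IH; intros t It [|k]; [exact Logic.I|].
      apply (ex_derive_ext (Derive_n f (S k)) (Derive_n (Derive f) k) t).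
      * intros y; rewrite (Derive_n_comp f k 1); f_equal; lia.
      * exact (H t It (S (S k))).
Qed.

(** The inner function has only finite order [n], because the lemma serves the bootstrap for the
    inverse time change, whose smoothness is still being proved. The chain rule replaces [g] by
    [Derive g], so the induction ranges over all [g]. *)
Lemma Ck3_time_comp (I J : R -> Prop) n g r : open1 I -> open1 J -> (forall y, J y -> I (r y)) ->
  Ck3 n (slab J) (fun y _ _ => r y) -> smooth_time I g -> Ck3 n (slab J) (fun y _ _ => g (r y)).
Proof.
  intros HI HJ Hr; revert g; induction n as [|n IH]; intros g Sr Sg.
  - split; [|exact Logic.I]. intros y x F Jy.
    apply (continuous_comp (fun p : R * R * R => r (fst (fst p))) g).
    + apply (Ck3_continuous _ _ _ Sr); exact Jy.
    + apply (ex_derive_continuous (V := R_NormedModule)), (smooth_time_ex_derive I); auto.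
  - apply (Ck3_time_S J n _ (fun y => Derive r y * Derive g (r y)) HJ).
    + intros y Jy; apply (is_derive_comp g r); apply Derive_correct;
        [apply (smooth_time_ex_derive I); auto | exact (proj1 (proj1 (proj2 Sr) y 0 0 Jy))].
    + apply (Ck3_mult J n HJ (fun t _ _ => Derive r t) (fun t _ _ => Derive g (r t))).
      * exact (proj1 (proj2 (proj2 Sr))).
      * apply IH; [apply Ck3_pred; exact Sr | apply smooth_time_Derive; exact Sg].
Qed.

(** * Passage between functions of (t, x) and of (t, x, F) *)

Lemma Ck2_of_Ck3 (I : R -> Prop) n F : forall f, Ck3 n (slab I) f ->
  Ck2 n (fun t _ => I t) (fun t x => f t x F).
Proof.
  assert (Hc : forall m f, Ck3 m (slab I) f -> forall t x, I t ->
    continuity_2d_pt (fun t x => f t x F) t x).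
  { intros m f Hf t x It. apply continuity_2d_pt_filterlim.
    apply (continuous_comp (fun z : R * R => (fst z, snd z, F) : R * R * R)
      (fun p : R * R * R => f (fst (fst p)) (snd (fst p)) (snd p))).
    - apply (continuous_comp_2 (fun z : R * R => (fst z, snd z) : R * R) (fun _ : R * R => F)
        (fun a b => (a, b) : R * R * R)).
      + apply (continuous_comp_2 (fun z : R * R => fst z) (fun z : R * R => snd z) (fun a b => (a, b) : R * R)).
        * apply continuous_fst.
        * apply continuous_snd.
        * apply (continuous_ext (fun z => z)); [intros []; reflexivity | apply continuous_id].
      + apply continuous_const.
      + apply (continuous_ext (fun z => z)); [intros []; reflexivity | apply continuous_id].
    - apply (Ck3_continuous _ _ _ Hf); exact It. }
  induction n as [|n IH]; intros f Hf.
  - split; [exact (Hc _ _ Hf)|exact Logic.I].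
  - split; [exact (Hc _ _ Hf)|].
    destruct Hf as [_ [He [Ht [Hx HF]]]].
    split; [|split].
    + intros t x It; destruct (He t x F It) as [E1 [E2 E3]]; split; assumption.
    + apply (IH _ Ht).
    + apply (IH _ Hx).
Qed.

Lemma Ck3_of_Ck2 (I : R -> Prop) n : open1 I -> forall f, Ck2 n (fun t _ => I t) f ->
  Ck3 n (slab I) (fun t x _ => f t x).
Proof.
  intros HI.
  assert (Hc : forall m f, Ck2 m (fun t _ => I t) f -> forall t x F, I t ->
    continuous (fun p : R * R * R => f (fst (fst p)) (snd (fst p))) (t, x, F)).
  { intros m f Hf t x F It.
    apply (continuous_comp (fun p : R * R * R => fst p) (fun z => f (fst z) (snd z))).
    - apply continuous_fst.
    - apply (continuity_2d_pt_filterlim f t x). destruct m; apply Hf; exact It. }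
  induction n as [|n IH]; intros f Hf.
  - split; [exact (Hc _ _ Hf)|exact Logic.I].
  - assert (Hc' := Hc _ _ Hf).
    destruct Hf as [_ [He [Ht Hx]]].
    apply Ck3_intro with (ft := fun t x _ => dt2 f t x) (fx := fun t x _ => dx2 f t x) (fF := fun _ _ _ => 0); auto.
    + intros t x F It; destruct (He t x It) as [E1 E2].
      split; [|split]; [apply Derive_correct; exact E1|apply Derive_correct; exact E2|apply @is_derive_const].
    + apply Ck3_const; exact HI.
Qed.

Lemma smooth2_of_smooth3 (I : R -> Prop) f F : smooth3 I f -> smooth2 (fun t _ => I t) (fun t x => f t x F).
Proof. intros H n; apply Ck2_of_Ck3, H. Qed.

Lemma smooth3_of_smooth2 (I : R -> Prop) f : open1 I -> smooth2 (fun t _ => I t) f -> smooth3 I (fun t x _ => f t x).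
Proof. intros HI H n; apply Ck3_of_Ck2; auto. Qed.

Lemma smooth_time_restrict (I : R -> Prop) f x F : open1 I -> smooth3 I f -> smooth_time I (fun t => f t x F).
Proof.
  intros HI H n; revert f H; induction n as [|n IH]; intros f H.
  - split; [|exact Logic.I]. intros t y G It.
    apply (continuous_comp (fun p : R * R * R => fst (fst p)) (fun s => f s x F)).
    + apply (continuous_comp (fun p : R * R * R => fst p) (fun q => fst q)); apply continuous_fst.
    + apply (ex_derive_continuous (V := R_NormedModule)); eexists; apply (smooth3_is_derive_t I); auto.
  - apply (Ck3_time_S I n _ (fun t => dt3 f t x F) HI).
    + intros t It; apply (smooth3_is_derive_t I); auto.
    + apply (IH (dt3 f)), smooth3_dt3, H.
Qed.

Lemma smooth3_restrict_F (I : R -> Prop) f F : open1 I -> smooth3 I f -> smooth3 I (fun t x _ => f t x F).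
Proof. intros HI H; apply (smooth3_of_smooth2 I (fun t x => f t x F) HI), smooth2_of_smooth3, H. Qed.

(** * Calculus on an interval *)

Lemma interval_inhabited (a b : Rbar) : Rbar_lt a b -> exists t, interval a b t.
Proof.
  destruct a as [a| |], b as [b| |]; simpl; intros H; try contradiction.
  - exists ((a + b) / 2); split; simpl; lra.
  - exists (a + 1); split; simpl; auto; lra.
  - exists (b - 1); split; simpl; auto; lra.
  - exists 0; split; simpl; auto.
Qed.

Lemma interval_between (a b : Rbar) s t y : interval a b s -> interval a b t ->
  Rmin s t <= y <= Rmax s t -> interval a b y.
Proof.
  intros Hs Ht Hy; split.
  - apply Rbar_lt_le_trans with (Rmin s t); [|simpl; lra].
    unfold Rmin; destruct Rle_dec; [apply Hs|apply Ht].
  - apply Rbar_le_lt_trans with (Rmax s t); [simpl; lra|].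
    unfold Rmax; destruct Rle_dec; [apply Ht|apply Hs].
Qed.

Lemma is_derive_zero_interval (a b : Rbar) (f : R -> R) :
  (forall t, interval a b t -> is_derive f t 0) ->
  exists c, forall t, interval a b t -> f t = c.
Proof.
  intros H.
  (* An empty interval offers no base point, but there every constant is correct. *)
  destruct (Classical_Prop.classic (exists t0, interval a b t0)) as [[t0 H0]|N].
  - exists (f t0); intros t It.
    destruct (MVT_gen f t0 t (fun _ => 0)) as [c [_ E]].
    + intros y Hy. apply H, (interval_between a b t0 t); auto; lra.
    + intros y Hy. apply continuity_pt_filterlim.
      apply (ex_derive_continuous (V := R_NormedModule)); exists 0; apply H, (interval_between a b t0 t); auto.
    + lra.
  - exists 0; intros t It; elim N; exists t; exact It.
Qed.

Lemma primitive_exists (a b : Rbar) (g : R -> R) : Rbar_lt a b ->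
  (forall t, interval a b t -> continuous g t) ->
  exists h, forall t, interval a b t -> is_derive h t (g t).
Proof.
  intros Hab Hc. destruct (interval_inhabited a b Hab) as [t0 H0].
  exists (fun t => RInt g t0 t); intros t It.
  apply (is_derive_RInt g (fun t => RInt g t0 t) t0).
  - generalize (open1_interval a b t It); apply filter_imp; intros y Iy.
    apply (RInt_correct (V := R_CompleteNormedModule)), (ex_RInt_continuous (V := R_CompleteNormedModule)).
    intros z Hz; apply Hc, (interval_between a b t0 y); auto.
  - apply Hc; exact It.
Qed.

(** * Second prolongation and determining equations *)

(** [auto_derive] leaves [Derive] terms in its result; each is replaced by the value recorded in an
    [is_derive] hypothesis. The inner match skips hypotheses whose value is that same [Derive] term,
    on which the loop would not end. *)
Ltac derive_values :=
  repeat match goal with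
  | H : is_derive ?f ?x ?l |- context [Derive ?g ?x] =>
      lazymatch l with
      | Derive g x => fail
      | _ => replace (Derive g x) with l by (symmetry; exact (is_derive_unique f x l H))
      end
  end.

Lemma total_x_lift f j : total_x (lift f) j = lift (dx3 f) j + j cFx * lift (dF3 f) j.
Proof.
  unfold total_x, lift, pd, upd; simpl. rewrite !Derive_const. unfold dx3, dF3; ring.
Qed.

Lemma total_t_lift f j : total_t (lift f) j = lift (dt3 f) j + j cFt * lift (dF3 f) j.
Proof.
  unfold total_t, lift, pd, upd; simpl. rewrite !Derive_const. unfold dt3, dF3; ring.
Qed.

Lemma eta_x_explicit X j : eta_x X j =
  (lift (dx3 (eta X)) j + j cFx * lift (dF3 (eta X)) j)
  - j cFt * (lift (dx3 (xi_t X)) j + j cFx * lift (dF3 (xi_t X)) j)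
  - j cFx * (lift (dx3 (xi_x X)) j + j cFx * lift (dF3 (xi_x X)) j).
Proof. unfold eta_x; rewrite !total_x_lift; reflexivity. Qed.

Lemma pd_unique c f g j l : (forall k, f k = g k) ->
  is_derive (fun s => g (upd j c s)) (j c) l -> pd c f j = l.
Proof.
  intros E H. unfold pd. rewrite (Derive_ext _ (fun s => g (upd j c s))).
  - apply is_derive_unique; exact H.
  - intros; apply E.
Qed.

(** This is the shape of [eta_x]: a polynomial in [l1] = F_t and [l2] = F_x whose coefficients
    depend on (t, x, F). Differentiating in x or in F keeps [l1] and [l2] fixed. *)
Lemma is_derive_prolongation_coefficient (a b c d e g : R -> R) (l1 l2 : R) (x da db dc dd de dg : R) :
  is_derive a x da -> is_derive b x db -> is_derive c x dc -> is_derive d x dd ->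
  is_derive e x de -> is_derive g x dg ->
  is_derive (fun s => (a s + l2 * b s) - l1 * (c s + l2 * d s) - l2 * (e s + l2 * g s)) x
    ((da + l2 * db) - l1 * (dc + l2 * dd) - l2 * (de + l2 * dg)).
Proof.
  intros Ha Hb Hc Hd He Hg.
  auto_derive.
  - repeat split; eexists; eassumption.
  - derive_values.
    ring.
Qed.

(** The factors 2 and 3 add contributions of the total derivative of [eta_x], through its F_t and
    F_x slots, to the correction terms subtracted in [eta_xx]. Both orders of the mixed partials are
    kept, so their equality is not invoked. *)
Lemma eta_xx_explicit (I : R -> Prop) X j : vf_smooth I X -> I (j ct) ->
  eta_xx X j =
  (lift (dx3 (dx3 (eta X))) j + j cFx * lift (dx3 (dF3 (eta X))) j
   - j cFt * (lift (dx3 (dx3 (xi_t X))) j + j cFx * lift (dx3 (dF3 (xi_t X))) j)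
   - j cFx * (lift (dx3 (dx3 (xi_x X))) j + j cFx * lift (dx3 (dF3 (xi_x X))) j))
  + j cFx * (lift (dF3 (dx3 (eta X))) j + j cFx * lift (dF3 (dF3 (eta X))) j
   - j cFt * (lift (dF3 (dx3 (xi_t X))) j + j cFx * lift (dF3 (dF3 (xi_t X))) j)
   - j cFx * (lift (dF3 (dx3 (xi_x X))) j + j cFx * lift (dF3 (dF3 (xi_x X))) j))
  - 2 * j cFtx * (lift (dx3 (xi_t X)) j + j cFx * lift (dF3 (xi_t X)) j)
  + j cFxx * (lift (dF3 (eta X)) j - j cFt * lift (dF3 (xi_t X)) j
     - 2 * lift (dx3 (xi_x X)) j - 3 * j cFx * lift (dF3 (xi_x X)) j).
Proof.
  intros [St [Sx Se]] It.
  assert (D : forall f, smooth3 I f -> smooth3 I (dx3 f) /\ smooth3 I (dF3 f))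
    by (intros f Hf; split; [apply smooth3_dx3 | apply smooth3_dF3]; exact Hf).
  destruct (D _ St) as [Stx StF], (D _ Sx) as [Sxx SxF], (D _ Se) as [Sex SeF].
  unfold eta_xx. rewrite !total_x_lift. unfold total_x.
  rewrite (pd_unique cx _ _ j (lift (dx3 (dx3 (eta X))) j + j cFx * lift (dx3 (dF3 (eta X))) j
   - j cFt * (lift (dx3 (dx3 (xi_t X))) j + j cFx * lift (dx3 (dF3 (xi_t X))) j)
   - j cFx * (lift (dx3 (dx3 (xi_x X))) j + j cFx * lift (dx3 (dF3 (xi_x X))) j)) (eta_x_explicit X)).
  2: { unfold upd, lift; simpl.
       apply is_derive_prolongation_coefficient; apply (smooth3_is_derive_x I); auto. }
  rewrite (pd_unique cF _ _ j (lift (dF3 (dx3 (eta X))) j + j cFx * lift (dF3 (dF3 (eta X))) j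
   - j cFt * (lift (dF3 (dx3 (xi_t X))) j + j cFx * lift (dF3 (dF3 (xi_t X))) j)
   - j cFx * (lift (dF3 (dx3 (xi_x X))) j + j cFx * lift (dF3 (dF3 (xi_x X))) j)) (eta_x_explicit X)).
  2: { unfold upd, lift; simpl.
       apply is_derive_prolongation_coefficient; apply (smooth3_is_derive_F I); auto. }
  rewrite (pd_unique cFt _ _ j (- (lift (dx3 (xi_t X)) j + j cFx * lift (dF3 (xi_t X)) j)) (eta_x_explicit X)).
  2: { unfold upd, lift; simpl. auto_derive; [exact Logic.I | ring]. }
  rewrite (pd_unique cFx _ _ j (lift (dF3 (eta X)) j - j cFt * lift (dF3 (xi_t X)) j
     - lift (dx3 (xi_x X)) j - 2 * j cFx * lift (dF3 (xi_x X)) j) (eta_x_explicit X)).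
  2: { unfold upd, lift; simpl. auto_derive; [exact Logic.I | ring]. }
  ring.
Qed.

Definition diffusion (sigma : R -> R) (t : R) : R := / 2 * sigma t ^ 2.
Definition drift (sigma p q : R -> R) (t x : R) : R := p t - diffusion sigma t - x * q t.

Lemma is_derive_diffusion sigma t : ex_derive sigma t ->
  is_derive (diffusion sigma) t (Derive (diffusion sigma) t).
Proof.
  intros H; apply Derive_correct. unfold diffusion. auto_derive; exact H.
Qed.

Lemma prolongation_model (I : R -> Prop) (sigma p q : R -> R) X j :
  vf_smooth I X -> I (j ct) ->
  ex_derive sigma (j ct) -> ex_derive p (j ct) -> ex_derive q (j ct) ->
  prolongation2 X (one_factor_model sigma p q) j =
    lift (xi_t X) j * (Derive (diffusion sigma) (j ct) * (j cFxx - j cFx)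
       + (Derive p (j ct) - j cx * Derive q (j ct)) * j cFx)
  - lift (xi_x X) j * q (j ct) * j cFx
  - eta_t X j + drift sigma p q (j ct) (j cx) * eta_x X j + diffusion sigma (j ct) * eta_xx X j.
Proof.
  intros HX It Ds Dp Dq. unfold prolongation2.
  assert (E : forall k, one_factor_model sigma p q k =
    diffusion sigma (k ct) * (k cFxx - k cFx) + (p (k ct) - k cx * q (k ct)) * k cFx - k cFt)
    by reflexivity.
  rewrite (pd_unique ct _ _ j (Derive (diffusion sigma) (j ct) * (j cFxx - j cFx)
       + (Derive p (j ct) - j cx * Derive q (j ct)) * j cFx) E).
  2: { unfold upd; simpl. assert (D := is_derive_diffusion sigma _ Ds).
       auto_derive; [repeat split; auto; eexists; exact D | ].
       change (fun x : R => diffusion sigma x) with (diffusion sigma).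
       change (fun x : R => p x) with p. change (fun x : R => q x) with q. ring. }
  rewrite (pd_unique cx _ _ j (- q (j ct) * j cFx) E).
  2: { unfold upd; simpl. auto_derive; [exact Logic.I|ring]. }
  rewrite (pd_unique cF _ _ j 0 E).
  2: { unfold upd; simpl. auto_derive; [exact Logic.I|ring]. }
  rewrite (pd_unique cFt _ _ j (-1) E).
  2: { unfold upd; simpl. auto_derive; [exact Logic.I|ring]. }
  rewrite (pd_unique cFx _ _ j (drift sigma p q (j ct) (j cx)) E).
  2: { unfold upd; simpl. auto_derive; [exact Logic.I|unfold drift; ring]. }
  rewrite (pd_unique cFtt _ _ j 0 E).
  2: { unfold upd; simpl. auto_derive; [exact Logic.I|ring]. }
  rewrite (pd_unique cFtx _ _ j 0 E).
  2: { unfold upd; simpl. auto_derive; [exact Logic.I|ring]. }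
  rewrite (pd_unique cFxx _ _ j (diffusion sigma (j ct)) E).
  2: { unfold upd; simpl. auto_derive; [exact Logic.I|ring]. }
  ring.
Qed.

(** F_tt is given the value 0, an arbitrary choice: it occurs neither in the model nor in the
    prolonged action on it. *)
Definition mk_jet (t x F Ft Fx Ftx Fxx : R) : jet := fun c =>
  match c with
  | ct => t | cx => x | cF => F | cFt => Ft | cFx => Fx | cFtt => 0 | cFtx => Ftx | cFxx => Fxx
  end.

Lemma Derive_zero_constant (f : R -> R) : (forall x, is_derive f x 0) -> forall x y, f x = f y.
Proof.
  intros H x y.
  destruct (is_derive_zero_interval m_infty p_infty f (fun t _ => H t)) as [c Hc].
  rewrite !Hc; try reflexivity; split; exact Logic.I.
Qed.

Lemma prolongation_model_explicit (I : R -> Prop) (sigma p q : R -> R) X j :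
  smooth_time I sigma -> smooth_time I p -> smooth_time I q ->
  vf_smooth I X -> I (j ct) ->
  let t := j ct in let x := j cx in let F := j cF in
  let Ft := j cFt in let Fx := j cFx in let Ftx := j cFtx in let Fxx := j cFxx in
  let tau := xi_t X in let xi := xi_x X in let et := eta X in
  prolongation2 X (one_factor_model sigma p q) j =
    tau t x F * (Derive (diffusion sigma) t * (Fxx - Fx) + (Derive p t - x * Derive q t) * Fx)
  - xi t x F * q t * Fx
  - (dt3 et t x F + Ft * dF3 et t x F - Ft * (dt3 tau t x F + Ft * dF3 tau t x F)
     - Fx * (dt3 xi t x F + Ft * dF3 xi t x F))
  + drift sigma p q t x *
    (dx3 et t x F + Fx * dF3 et t x F - Ft * (dx3 tau t x F + Fx * dF3 tau t x F)
     - Fx * (dx3 xi t x F + Fx * dF3 xi t x F))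
  + diffusion sigma t *
    ((dx3 (dx3 et) t x F + Fx * dx3 (dF3 et) t x F
       - Ft * (dx3 (dx3 tau) t x F + Fx * dx3 (dF3 tau) t x F)
       - Fx * (dx3 (dx3 xi) t x F + Fx * dx3 (dF3 xi) t x F))
     + Fx * (dF3 (dx3 et) t x F + Fx * dF3 (dF3 et) t x F
       - Ft * (dF3 (dx3 tau) t x F + Fx * dF3 (dF3 tau) t x F)
       - Fx * (dF3 (dx3 xi) t x F + Fx * dF3 (dF3 xi) t x F))
     - 2 * Ftx * (dx3 tau t x F + Fx * dF3 tau t x F)
     + Fxx * (dF3 et t x F - Ft * dF3 tau t x F - 2 * dx3 xi t x F - 3 * Fx * dF3 xi t x F)).
Proof.
  intros Ss Sp Sq HX It t x F Ft Fx Ftx Fxx tau xi et.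
  rewrite (prolongation_model I _ _ _ _ j HX It (smooth_time_ex_derive I _ _ Ss It)
    (smooth_time_ex_derive I _ _ Sp It) (smooth_time_ex_derive I _ _ Sq It)).
  rewrite (eta_xx_explicit I X j HX It), eta_x_explicit.
  unfold eta_t; rewrite !total_t_lift. reflexivity.
Qed.

Lemma prolongation_mk_jet (I : R -> Prop) (sigma p q : R -> R) X t x F Ft Fx Ftx Fxx :
  smooth_time I sigma -> smooth_time I p -> smooth_time I q ->
  vf_smooth I X -> I t ->
  let tau := xi_t X in let xi := xi_x X in let et := eta X in
  prolongation2 X (one_factor_model sigma p q) (mk_jet t x F Ft Fx Ftx Fxx) =
    tau t x F * (Derive (diffusion sigma) t * (Fxx - Fx) + (Derive p t - x * Derive q t) * Fx)
  - xi t x F * q t * Fx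
  - (dt3 et t x F + Ft * dF3 et t x F - Ft * (dt3 tau t x F + Ft * dF3 tau t x F)
     - Fx * (dt3 xi t x F + Ft * dF3 xi t x F))
  + drift sigma p q t x *
    (dx3 et t x F + Fx * dF3 et t x F - Ft * (dx3 tau t x F + Fx * dF3 tau t x F)
     - Fx * (dx3 xi t x F + Fx * dF3 xi t x F))
  + diffusion sigma t *
    ((dx3 (dx3 et) t x F + Fx * dx3 (dF3 et) t x F
       - Ft * (dx3 (dx3 tau) t x F + Fx * dx3 (dF3 tau) t x F)
       - Fx * (dx3 (dx3 xi) t x F + Fx * dx3 (dF3 xi) t x F))
     + Fx * (dF3 (dx3 et) t x F + Fx * dF3 (dF3 et) t x F
       - Ft * (dF3 (dx3 tau) t x F + Fx * dF3 (dF3 tau) t x F)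
       - Fx * (dF3 (dx3 xi) t x F + Fx * dF3 (dF3 xi) t x F))
     - 2 * Ftx * (dx3 tau t x F + Fx * dF3 tau t x F)
     + Fxx * (dF3 et t x F - Ft * dF3 tau t x F - 2 * dx3 xi t x F - 3 * Fx * dF3 xi t x F)).
Proof.
  intros Ss Sp Sq HX It.
  exact (prolongation_model_explicit I sigma p q X (mk_jet t x F Ft Fx Ftx Fxx) Ss Sp Sq HX It).
Qed.

Lemma dx3_zero (I : R -> Prop) f t x F : (forall t x F, I t -> f t x F = 0) -> I t -> dx3 f t x F = 0.
Proof.
  intros H It; unfold dx3; rewrite (Derive_ext _ (fun _ => 0)); [apply Derive_const | auto].
Qed.

Lemma dF3_zero (I : R -> Prop) f t x F : (forall t x F, I t -> f t x F = 0) -> I t -> dF3 f t x F = 0.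
Proof.
  intros H It; unfold dF3; rewrite (Derive_ext _ (fun _ => 0)); [apply Derive_const | auto].
Qed.

Lemma F_independent (I : R -> Prop) f : smooth3 I f ->
  (forall t x F, I t -> dF3 f t x F = 0) -> forall t x F G, I t -> f t x F = f t x G.
Proof.
  intros S H t x F G It. apply (Derive_zero_constant (fun v => f t x v)).
  intros v; rewrite <- (H t x v It); apply (smooth3_is_derive_F I); auto.
Qed.

Lemma x_independent (I : R -> Prop) f : smooth3 I f ->
  (forall t x F, I t -> dx3 f t x F = 0) -> forall t x y F, I t -> f t x F = f t y F.
Proof.
  intros S H t x y F It. apply (Derive_zero_constant (fun v => f t v F)).
  intros v; rewrite <- (H t v F It); apply (smooth3_is_derive_x I); auto.
Qed.

(* On the solution set [F_t] is determined by [F_x] and [F_xx], which stay free together with [F_tx]: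
   the coefficients of [F_tx], [F_x F_xx] and [F_x^2] in the symmetry condition vanish separately. *)
Lemma symmetry_projectable (I : R -> Prop) (sigma p q : R -> R) X :
  smooth_time I sigma -> smooth_time I p -> smooth_time I q ->
  (forall t, I t -> 0 < diffusion sigma t) ->
  lie_symmetry I (one_factor_model sigma p q) X ->
  forall t x F, I t ->
    dx3 (xi_t X) t x F = 0 /\ dF3 (xi_t X) t x F = 0 /\ dF3 (xi_x X) t x F = 0 /\
    dF3 (dF3 (eta X)) t x F = 0.
Proof.
  intros Ss Sp Sq HA [HX HL].
  assert (L : forall t x F Fx Ftx Fxx, I t ->
    prolongation2 X (one_factor_model sigma p q)
     (mk_jet t x F (diffusion sigma t * Fxx + drift sigma p q t x * Fx) Fx Ftx Fxx) = 0).
  { intros; apply HL; [assumption|].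
    unfold one_factor_model, mk_jet, drift, diffusion; ring. }
  assert (T : forall t x F, I t -> dx3 (xi_t X) t x F = 0 /\ dF3 (xi_t X) t x F = 0).
  { intros t x F It. assert (A := HA t It).
    assert (E : forall Fx, dx3 (xi_t X) t x F + Fx * dF3 (xi_t X) t x F = 0).
    (* The two jets differ only in F_tx, whose coefficient is -2 A (tau_x + F_x tau_F). *)
    { intros Fx. generalize (L t x F Fx 1 0 It) (L t x F Fx 0 0 It).
      rewrite !(prolongation_mk_jet I) by assumption; intros E1 E0.
      apply (Rmult_eq_reg_l (diffusion sigma t)); lra. }
    generalize (E 0) (E 1); lra. }
  assert (Sx : smooth3 I (xi_x X)) by apply HX.
  assert (Tx : forall t x F, I t -> dF3 (xi_x X) t x F = 0).
  { intros t x F It. assert (A := HA t It). destruct (T t x F It) as [Tx TF].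
    (* The mixed second difference in (F_x, F_xx) isolates the coefficient of F_x F_xx. Eliminating
       F_t contributes A xi_F and [eta_xx] contributes -3 A xi_F, which leaves -2 A xi_F. *)
    generalize (L t x F 1 0 1 It) (L t x F 0 0 1 It) (L t x F 1 0 0 It) (L t x F 0 0 0 It).
    rewrite !(prolongation_mk_jet I) by assumption.
    rewrite Tx, TF, (dx3_zero I (dx3 (xi_t X))), (dx3_zero I (dF3 (xi_t X))),
      (dF3_zero I (dx3 (xi_t X))), (dF3_zero I (dF3 (xi_t X))) by (try assumption; intros; apply T; assumption).
    intros E1 E2 E3 E4.
    apply (Rmult_eq_reg_l (diffusion sigma t)); lra. }
  intros t x F It. assert (A := HA t It). destruct (T t x F It) as [Tx' TF].
  split; [exact Tx'|split; [exact TF|split; [apply Tx; exact It|]]].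
  assert (M : dF3 (dx3 (xi_x X)) t x F = 0).
  { unfold dF3. rewrite (Derive_ext _ (fun _ => dx3 (xi_x X) t x F)); [apply Derive_const|].
    intros v; unfold dx3; apply Derive_ext; intros y; apply (F_independent I); auto. }
  (* The second difference in F_x is twice the coefficient of F_x^2, which is A eta_FF once all
     F-derivatives of [xi_x X] are gone. *)
  generalize (L t x F 1 0 0 It) (L t x F (-1) 0 0 It) (L t x F 0 0 0 It).
  rewrite !(prolongation_mk_jet I) by assumption.
  rewrite Tx', TF, (dx3_zero I (dx3 (xi_t X))), (dx3_zero I (dF3 (xi_t X))),
      (dF3_zero I (dx3 (xi_t X))), (dF3_zero I (dF3 (xi_t X))) by (try assumption; intros; apply T; assumption).
  rewrite M, (Tx t x F It), (dx3_zero I (dF3 (xi_x X))), (dF3_zero I (dF3 (xi_x X))) by assumption.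
  intros E1 E2 E3.
  apply (Rmult_eq_reg_l (diffusion sigma t)); lra.
Qed.

(** * Fields affine in F *)

Lemma dt3_ext (I : R -> Prop) f g : open1 I -> (forall t x F, I t -> f t x F = g t x F) ->
  forall t x F, I t -> dt3 f t x F = dt3 g t x F.
Proof.
  intros HI E t x F It; unfold dt3; apply Derive_ext_loc.
  apply (open1_ext_loc I _ _ t HI); auto.
Qed.

Lemma dx3_ext (I : R -> Prop) f g : (forall t x F, I t -> f t x F = g t x F) ->
  forall t x F, I t -> dx3 f t x F = dx3 g t x F.
Proof. intros E t x F It; apply Derive_ext; auto. Qed.

Lemma dF3_ext (I : R -> Prop) f g : (forall t x F, I t -> f t x F = g t x F) ->
  forall t x F, I t -> dF3 f t x F = dF3 g t x F.
Proof. intros E t x F It; apply Derive_ext; auto. Qed.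

(** Fields identified by [vf_eq] may differ outside the slab. The symmetry condition sees only
    partial derivatives at points of the slab, and these agree: in t because [I] is open, in x and F
    because whole lines lie in the slab. *)
Lemma lie_symmetry_ext (I : R -> Prop) (sigma p q : R -> R) X Y : open1 I ->
  smooth_time I sigma -> smooth_time I p -> smooth_time I q -> vf_eq I X Y ->
  lie_symmetry I (one_factor_model sigma p q) Y -> lie_symmetry I (one_factor_model sigma p q) X.
Proof.
  intros HI Ss Sp Sq E [SY HY].
  assert (E1 : forall t x F, I t -> xi_t X t x F = xi_t Y t x F) by (intros; apply E; assumption).
  assert (E2 : forall t x F, I t -> xi_x X t x F = xi_x Y t x F) by (intros; apply E; assumption).
  assert (E3 : forall t x F, I t -> eta X t x F = eta Y t x F) by (intros; apply E; assumption).
  assert (SX : vf_smooth I X).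
  { destruct SY as [S1 [S2 S3]].
    split; [|split]; [apply (smooth3_ext I (xi_t Y)) | apply (smooth3_ext I (xi_x Y)) | apply (smooth3_ext I (eta Y))];
      auto; intros; symmetry; auto. }
  split; [exact SX|].
  intros j It Ej; rewrite <- (HY j It Ej).
  rewrite !(prolongation_model_explicit I) by assumption.
  rewrite !(E1 _ _ _ It), !(E2 _ _ _ It).
  rewrite !(dt3_ext I _ _ HI E1 _ _ _ It), !(dt3_ext I _ _ HI E2 _ _ _ It), !(dt3_ext I _ _ HI E3 _ _ _ It).
  rewrite !(dx3_ext I _ _ E1 _ _ _ It), !(dx3_ext I _ _ E2 _ _ _ It), !(dx3_ext I _ _ E3 _ _ _ It).
  rewrite !(dF3_ext I _ _ E1 _ _ _ It), !(dF3_ext I _ _ E2 _ _ _ It), !(dF3_ext I _ _ E3 _ _ _ It).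
  rewrite !(dx3_ext I _ _ (dx3_ext I _ _ E1) _ _ _ It), !(dx3_ext I _ _ (dx3_ext I _ _ E2) _ _ _ It),
    !(dx3_ext I _ _ (dx3_ext I _ _ E3) _ _ _ It).
  rewrite !(dF3_ext I _ _ (dx3_ext I _ _ E1) _ _ _ It), !(dF3_ext I _ _ (dx3_ext I _ _ E2) _ _ _ It),
    !(dF3_ext I _ _ (dx3_ext I _ _ E3) _ _ _ It).
  rewrite !(dx3_ext I _ _ (dF3_ext I _ _ E1) _ _ _ It), !(dx3_ext I _ _ (dF3_ext I _ _ E2) _ _ _ It),
    !(dx3_ext I _ _ (dF3_ext I _ _ E3) _ _ _ It).
  rewrite !(dF3_ext I _ _ (dF3_ext I _ _ E1) _ _ _ It), !(dF3_ext I _ _ (dF3_ext I _ _ E2) _ _ _ It),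
    !(dF3_ext I _ _ (dF3_ext I _ _ E3) _ _ _ It).
  reflexivity.
Qed.

Definition affine_field (tau : R -> R) (xi f g : R -> R -> R) : vfield :=
  VField (fun t _ _ => tau t) (fun t x _ => xi t x) (fun t x F => f t x * F + g t x).

Notation smooth_slab I f := (smooth2 (fun t _ => I t) f).

Lemma vf_smooth_affine (I : R -> Prop) tau xi f g : open1 I -> smooth_time I tau ->
  smooth_slab I xi -> smooth_slab I f -> smooth_slab I g ->
  vf_smooth I (affine_field tau xi f g).
Proof.
  intros HI St Sx Sf Sg; split; [exact St|split]; simpl.
  - apply smooth3_of_smooth2; auto.
  - apply smooth3_plus; [exact HI| |apply smooth3_of_smooth2; auto].
    apply (smooth3_mult I (fun t x _ => f t x) (fun _ _ F => F)); [exact HI| |apply smooth3_F; exact HI].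
    apply smooth3_of_smooth2; auto.
Qed.

Lemma smooth2_dt2 (U : R -> R -> Prop) f : smooth2 U f -> smooth2 U (dt2 f).
Proof. intros H n; exact (proj1 (proj2 (proj2 (H (S n))))). Qed.

Lemma smooth2_dx2 (U : R -> R -> Prop) f : smooth2 U f -> smooth2 U (dx2 f).
Proof. intros H n; exact (proj2 (proj2 (proj2 (H (S n))))). Qed.

Lemma smooth2_is_derive_t (U : R -> R -> Prop) f t x : smooth2 U f -> U t x ->
  is_derive (fun s => f s x) t (dt2 f t x).
Proof. intros H It. exact (Derive_correct _ _ (proj1 (proj1 (proj2 (H 1%nat)) t x It))). Qed.

Lemma smooth2_is_derive_x (U : R -> R -> Prop) f t x : smooth2 U f -> U t x ->
  is_derive (fun y => f t y) x (dx2 f t x).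
Proof. intros H It. exact (Derive_correct _ _ (proj2 (proj1 (proj2 (H 1%nat)) t x It))). Qed.

Lemma is_derive_linear_comb (f g : R -> R) t F a b : is_derive f t a -> is_derive g t b ->
  is_derive (fun s => f s * F + g s) t (a * F + b).
Proof.
  intros H1 H2. auto_derive; [repeat split; eexists; eassumption|].
  derive_values; ring.
Qed.

Lemma prolongation_affine (I : R -> Prop) (sigma p q : R -> R) tau xi f g j : open1 I ->
  smooth_time I sigma -> smooth_time I p -> smooth_time I q ->
  smooth_time I tau -> smooth_slab I xi -> smooth_slab I f -> smooth_slab I g -> I (j ct) ->
  let t := j ct in let x := j cx in let F := j cF in
  let Ft := j cFt in let Fx := j cFx in let Fxx := j cFxx in
  prolongation2 (affine_field tau xi f g) (one_factor_model sigma p q) j =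
    tau t * (Derive (diffusion sigma) t * (Fxx - Fx) + (Derive p t - x * Derive q t) * Fx)
  - xi t x * q t * Fx
  - (dt2 f t x * F + dt2 g t x + Ft * f t x - Ft * Derive tau t - Fx * dt2 xi t x)
  + drift sigma p q t x * (dx2 f t x * F + dx2 g t x + Fx * f t x - Fx * dx2 xi t x)
  + diffusion sigma t *
    (dx2 (dx2 f) t x * F + dx2 (dx2 g) t x + 2 * Fx * dx2 f t x - Fx * dx2 (dx2 xi) t x
     + Fxx * (f t x - 2 * dx2 xi t x)).
Proof.
  intros HI Ss Sp Sq St Sx Sf Sg It.
  rewrite (prolongation_model_explicit I) by (try apply vf_smooth_affine; assumption).
  cbv zeta; cbn [affine_field xi_t xi_x eta].
  set (t := j ct) in *; set (x := j cx); set (F := j cF).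
  assert (Z : forall t x F, I t -> dx3 (fun t _ _ => tau t) t x F = 0) by (intros; exact (Derive_const _ _)).
  assert (Z' : forall t x F, I t -> dF3 (fun t _ _ => tau t) t x F = 0) by (intros; exact (Derive_const _ _)).
  assert (Z'' : forall t x F, I t -> dF3 (fun t x _ => xi t x) t x F = 0) by (intros; exact (Derive_const _ _)).
  assert (Et : forall t x F, I t -> dt3 (fun t x F => f t x * F + g t x) t x F = dt2 f t x * F + dt2 g t x).
  { intros; apply is_derive_unique, is_derive_linear_comb; apply (smooth2_is_derive_t (fun t _ => I t)); auto. }
  assert (Ex : forall t x F, I t -> dx3 (fun t x F => f t x * F + g t x) t x F = dx2 f t x * F + dx2 g t x).
  { intros; apply is_derive_unique, is_derive_linear_comb; apply (smooth2_is_derive_x (fun t _ => I t)); auto. }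
  assert (EF : forall t x F, I t -> dF3 (fun t x F => f t x * F + g t x) t x F = f t x).
  { intros; apply is_derive_unique; auto_derive; [exact Logic.I|ring]. }
  rewrite (dx3_zero I (dx3 (fun t _ _ => tau t))), (dF3_zero I (dx3 (fun t _ _ => tau t))),
    (dx3_zero I (dF3 (fun t _ _ => tau t))), (dF3_zero I (dF3 (fun t _ _ => tau t))),
    (dx3_zero I (dF3 (fun t x _ => xi t x))), (dF3_zero I (dF3 (fun t x _ => xi t x))) by assumption.
  rewrite Z, Z', Z'', Et, Ex, EF by assumption.
  rewrite (dx3_ext I _ _ Ex t x F It), (dF3_ext I _ _ Ex t x F It),
    (dx3_ext I _ _ EF t x F It), (dF3_ext I _ _ EF t x F It).
  replace (dx3 (fun t x F => dx2 f t x * F + dx2 g t x) t x F) with (dx2 (dx2 f) t x * F + dx2 (dx2 g) t x).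
  2: { symmetry; apply is_derive_unique, is_derive_linear_comb; apply (smooth2_is_derive_x (fun t _ => I t));
       auto using smooth2_dx2. }
  replace (dF3 (fun t x F => dx2 f t x * F + dx2 g t x) t x F) with (dx2 f t x).
  2: { symmetry; apply is_derive_unique; auto_derive; [exact Logic.I|ring]. }
  replace (dF3 (fun t x _ => f t x) t x F) with 0 by (symmetry; exact (Derive_const _ _)).
  replace (dF3 (dx3 (fun t x _ => xi t x)) t x F) with 0 by (symmetry; exact (Derive_const _ _)).
  change (dt3 (fun t _ _ => tau t) t x F) with (Derive tau t).
  change (dt3 (fun t x _ => xi t x) t x F) with (dt2 xi t x).
  change (dx3 (fun t x _ => xi t x) t x F) with (dx2 xi t x).
  change (dx3 (dx3 (fun t x _ => xi t x)) t x F) with (dx2 (dx2 xi) t x).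
  change (dx3 (fun t x _ => f t x) t x F) with (dx2 f t x).
  ring.
Qed.

Definition model_operator (sigma p q : R -> R) (f : R -> R -> R) (t x : R) : R :=
  diffusion sigma t * dx2 (dx2 f) t x + drift sigma p q t x * dx2 f t x - dt2 f t x.

Lemma solves_model (I : R -> Prop) (sigma p q : R -> R) f :
  solves (fun t _ => I t) (one_factor_model sigma p q) f <->
  forall t x, I t -> model_operator sigma p q f t x = 0.
Proof.
  assert (E : forall t x, one_factor_model sigma p q (jet_of f t x) = model_operator sigma p q f t x).
  { intros; unfold one_factor_model, model_operator, drift, diffusion; simpl; ring. }
  split; intros H t x It; [rewrite <- E | rewrite E]; apply H; exact It.
Qed.

(** These are the coefficients of F_xx, F_x, F and 1 in the symmetry condition after the
    substitution F_t = A F_xx + [drift] F_x. *)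
Definition affine_determining (I : R -> Prop) (sigma p q tau : R -> R) (xi f g : R -> R -> R) : Prop :=
  forall t x, I t ->
  tau t * Derive (diffusion sigma) t + diffusion sigma t * Derive tau t = 2 * diffusion sigma t * dx2 xi t x /\
  tau t * (Derive p t - Derive (diffusion sigma) t - x * Derive q t) - xi t x * q t
    + drift sigma p q t x * (Derive tau t - dx2 xi t x) + dt2 xi t x
    + diffusion sigma t * (2 * dx2 f t x - dx2 (dx2 xi) t x) = 0 /\
  model_operator sigma p q f t x = 0 /\ model_operator sigma p q g t x = 0.

Lemma affine_symmetry (I : R -> Prop) (sigma p q : R -> R) tau xi f g : open1 I ->
  smooth_time I sigma -> smooth_time I p -> smooth_time I q ->
  smooth_time I tau -> smooth_slab I xi -> smooth_slab I f -> smooth_slab I g ->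
  lie_symmetry I (one_factor_model sigma p q) (affine_field tau xi f g) <->
  affine_determining I sigma p q tau xi f g.
Proof.
  intros HI Ss Sp Sq St Sx Sf Sg. split.
  - intros [_ HL] t x It.
    assert (L : forall F Fx Fxx, prolongation2 (affine_field tau xi f g) (one_factor_model sigma p q)
      (mk_jet t x F (diffusion sigma t * Fxx + drift sigma p q t x * Fx) Fx 0 Fxx) = 0).
    { intros; apply HL; [assumption|].
      unfold one_factor_model, mk_jet, drift, diffusion; ring. }
    (* With F_t eliminated the condition is affine in (F, F_x, F_xx), so its values at the origin
       and at the three unit vectors give all four coefficients. *)
    assert (L0 := L 0 0 0). assert (L1 := L 0 0 1). assert (L2 := L 0 1 0). assert (L3 := L 1 0 0).
    rewrite (prolongation_affine I) in L0, L1, L2, L3 by assumption.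
    simpl in L0, L1, L2, L3. unfold model_operator.
    unfold drift in *. repeat split; lra.
  - intros HD; split; [apply vf_smooth_affine; assumption|].
    intros j It Ej. rewrite (prolongation_affine I) by assumption.
    destruct (HD (j ct) (j cx) It) as [D1 [D2 [D3 D4]]].
    assert (EFt : j cFt = diffusion sigma (j ct) * j cFxx + drift sigma p q (j ct) (j cx) * j cFx).
    { unfold one_factor_model in Ej; unfold drift, diffusion; lra. }
    rewrite EFt. unfold model_operator in D3, D4.
    assert (C : forall a b c d e f : R, a = 0 -> b = 0 -> c = 0 -> d = 0 ->
      a * j cFxx + b * j cFx + c * j cF + d = 0) by (intros; subst; ring).
    rewrite <- (C _ _ _ _ 0 0 (Rminus_diag_eq _ _ D1) D2 D3 D4).
    unfold drift; ring.
Qed.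

Lemma symmetry_affine (I : R -> Prop) (sigma p q : R -> R) X : open1 I ->
  smooth_time I sigma -> smooth_time I p -> smooth_time I q ->
  (forall t, I t -> 0 < diffusion sigma t) ->
  lie_symmetry I (one_factor_model sigma p q) X ->
  exists tau xi f g,
    smooth_time I tau /\ smooth_slab I xi /\ smooth_slab I f /\ smooth_slab I g /\
    vf_eq I X (affine_field tau xi f g) /\ affine_determining I sigma p q tau xi f g.
Proof.
  intros HI Ss Sp Sq HA HX.
  assert (P := symmetry_projectable I sigma p q X Ss Sp Sq HA HX).
  assert (SX : vf_smooth I X) by apply HX.
  destruct SX as [S1 [S2 S3]].
  pose (tau := fun t => xi_t X t 0 0). pose (xi := fun t x => xi_x X t x 0).
  (* Since [eta X] is affine in F, its values at F = 0 and F = 1 determine it. *)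
  pose (f := fun t x => eta X t x 1 - eta X t x 0). pose (g := fun t x => eta X t x 0).
  assert (T1 : smooth_time I tau) by (apply smooth_time_restrict; assumption).
  assert (T2 : smooth_slab I xi) by (apply smooth2_of_smooth3; assumption).
  assert (T3 : smooth_slab I g) by (apply smooth2_of_smooth3; assumption).
  assert (T4 : smooth_slab I f).
  { apply (smooth2_of_smooth3 I (fun t x _ => eta X t x 1 - eta X t x 0) 0).
    apply smooth3_minus; [exact HI| |]; apply smooth3_restrict_F; assumption. }
  exists tau, xi, f, g.
  assert (E : vf_eq I X (affine_field tau xi f g)).
  { intros t x F It; simpl; split; [|split].
    - unfold tau. rewrite (F_independent I _ S1 (fun t x F It => proj1 (proj2 (P t x F It))) t x F 0 It).
      apply (x_independent I _ S1 (fun t x F It => proj1 (P t x F It)) t x 0 0 It).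
    - apply (F_independent I _ S2 (fun t x F It => proj1 (proj2 (proj2 (P t x F It)))) t x F 0 It).
    - assert (D : forall v, dF3 (eta X) t x v = dF3 (eta X) t x 0).
      { intros v. apply (F_independent I (dF3 (eta X)) (smooth3_dF3 I _ S3)
          (fun t x F It => proj2 (proj2 (proj2 (P t x F It)))) t x v 0 It). }
      assert (L : forall v w, eta X t x v - v * dF3 (eta X) t x 0 = eta X t x w - w * dF3 (eta X) t x 0).
      { intros v w. apply (Derive_zero_constant (fun v => eta X t x v - v * dF3 (eta X) t x 0)).
        intros u. assert (Du := smooth3_is_derive_F I _ t x u S3 It).
        auto_derive; [repeat split; eexists; exact Du|].
        derive_values. rewrite D; ring. }
      generalize (L F 0) (L 1 0); unfold f, g; intros L1 L2.
      replace (eta X t x 1 - eta X t x 0) with (dF3 (eta X) t x 0) by lra. lra. }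
  refine (conj T1 (conj T2 (conj T4 (conj T3 (conj E _))))).
  apply (affine_symmetry I); try assumption.
  apply (lie_symmetry_ext I _ _ _ _ X); try assumption.
  intros t x F It; destruct (E t x F It) as [E1 [E2 E3]]; repeat split; symmetry; assumption.
Qed.

(** * Heat coordinates *)

(* The time change [s] and the space coordinate [y = rho t * x + beta t] turn the
   model into the heat equation [u_s = u_yy]. *)
Record heat_coordinates (I : R -> Prop) (sigma p q rho beta s : R -> R) : Prop := {
  hc_open : open1 I;
  hc_sigma : smooth_time I sigma;
  hc_p : smooth_time I p;
  hc_q : smooth_time I q;
  hc_rho : smooth_time I rho;
  hc_beta : smooth_time I beta;
  hc_s : smooth_time I s;
  hc_diffusion_pos : forall t, I t -> 0 < diffusion sigma t;
  hc_rho_pos : forall t, I t -> 0 < rho t;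
  hc_drho : forall t, I t -> is_derive rho t (- q t * rho t);
  hc_dbeta : forall t, I t -> is_derive beta t ((p t - diffusion sigma t) * rho t);
  hc_ds : forall t, I t -> is_derive s t (diffusion sigma t * rho t ^ 2)
}.

Lemma smooth_diffusion (I : R -> Prop) sigma : open1 I -> smooth_time I sigma ->
  smooth_time I (diffusion sigma).
Proof.
  intros HI S. apply (smooth3_mult I (fun _ _ _ => / 2) (fun t _ _ => sigma t ^ 2) HI).
  - apply smooth3_const; exact HI.
  - apply (smooth3_pow I (fun t _ _ => sigma t)); assumption.
Qed.

Lemma heat_coordinates_exist (a b : Rbar) (sigma p q : R -> R) : Rbar_lt a b ->
  smooth_time (interval a b) sigma -> smooth_time (interval a b) p -> smooth_time (interval a b) q ->
  (forall t, interval a b t -> sigma t <> 0) ->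
  exists rho beta s, heat_coordinates (interval a b) sigma p q rho beta s.
Proof.
  intros Hab Ss Sp Sq Hnz.
  set (I := interval a b) in *. assert (HI : open1 I) by apply open1_interval.
  assert (SA := smooth_diffusion I sigma HI Ss).
  assert (cont : forall f t, smooth_time I f -> I t -> continuous f t).
  { intros f t Sf It. apply (ex_derive_continuous (V := R_NormedModule)), (smooth_time_ex_derive I); assumption. }
  destruct (primitive_exists a b q Hab (fun t It => cont q t Sq It)) as [k Hk].
  pose (rho := fun t => exp (- k t)).
  assert (Drho : forall t, I t -> is_derive rho t (- q t * rho t)).
  { intros t It. assert (D := Hk t It). unfold rho. auto_derive; [eexists; exact D|].
    derive_values; ring. }
  assert (Srho : smooth_time I rho).
  { apply (smooth_time_linear_ode I rho (fun t => - q t) HI Drho).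
    apply (smooth3_opp I (fun t _ _ => q t)); assumption. }
  assert (Sb : smooth_time I (fun t => (p t - diffusion sigma t) * rho t)).
  { apply (smooth3_mult I (fun t _ _ => p t - diffusion sigma t) (fun t _ _ => rho t)); try assumption.
    apply (smooth3_minus I (fun t _ _ => p t) (fun t _ _ => diffusion sigma t)); assumption. }
  assert (Sds : smooth_time I (fun t => diffusion sigma t * rho t ^ 2)).
  { apply (smooth3_mult I (fun t _ _ => diffusion sigma t) (fun t _ _ => rho t ^ 2)); try assumption.
    apply (smooth3_pow I (fun t _ _ => rho t)); assumption. }
  destruct (primitive_exists a b _ Hab (fun t It => cont _ t Sb It)) as [beta Hb].
  destruct (primitive_exists a b _ Hab (fun t It => cont _ t Sds It)) as [s Hs].
  exists rho, beta, s; constructor; try assumption.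
  - apply (smooth_time_primitive I beta _ HI Hb Sb).
  - apply (smooth_time_primitive I s _ HI Hs Sds).
  - intros t It. unfold diffusion. assert (0 < sigma t ^ 2) by (apply pow2_gt_0, Hnz; exact It). lra.
  - intros t _; apply exp_pos.
Qed.

(* The heat symmetry with [xi^s = c0 + c1 s + c2 s^2] and [xi^y = (c1 / 2 + c2 s) y + g0 + g1 s],
   written in the original coordinates. *)
Definition heat_tau (sigma rho s : R -> R) (c0 c1 c2 t : R) : R :=
  (c0 + c1 * s t + c2 * s t ^ 2) / (diffusion sigma t * rho t ^ 2).
(** Solves xi^y = tau y_t + xi y_x for xi, where y_x = [rho] and y_t = [rho] times [drift]. *)
Definition heat_xi (sigma p q rho beta s : R -> R) (c0 c1 c2 g0 g1 t x : R) : R :=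
  ((c1 / 2 + c2 * s t) * (rho t * x + beta t) + (g0 + g1 * s t)) / rho t
  - drift sigma p q t x * heat_tau sigma rho s c0 c1 c2 t.
(** The heat determining equations give f_y = - (xi^y)_s / 2 and f_s = f_yy = - c2 / 2. The free
    constant is normalised so that the s-dependent part is - (xi^s)' / 4; with this choice the three
    sl2 generators close without a central term. *)
Definition heat_f (rho beta s : R -> R) (c1 c2 g1 z t x : R) : R :=
  - (c2 / 4) * (rho t * x + beta t) ^ 2 - g1 / 2 * (rho t * x + beta t)
  - (c1 + 2 * c2 * s t) / 4 + z.

Record heat_derivatives (sigma p q rho beta s : R -> R) (t : R) : Prop := {
  hd_A : 0 < diffusion sigma t;
  hd_rho : 0 < rho t;
  hd_dA : is_derive (diffusion sigma) t (Derive (diffusion sigma) t);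
  hd_dp : is_derive p t (Derive p t);
  hd_dq : is_derive q t (Derive q t);
  hd_drho : is_derive rho t (- q t * rho t);
  hd_dbeta : is_derive beta t ((p t - diffusion sigma t) * rho t);
  hd_ds : is_derive s t (diffusion sigma t * rho t ^ 2)
}.

Lemma heat_coordinates_derivatives (I : R -> Prop) sigma p q rho beta s t :
  heat_coordinates I sigma p q rho beta s -> I t -> heat_derivatives sigma p q rho beta s t.
Proof.
  intros [] It; constructor; auto; apply Derive_correct, (smooth_time_ex_derive I); auto using smooth_diffusion.
Qed.

(** The product of tau with s' = A rho^2 is a quadratic in [s], and the logarithmic derivative of A
    rho^2 is A'/A - 2 q. *)
Lemma is_derive_heat_tau sigma p q rho beta s c0 c1 c2 t : heat_derivatives sigma p q rho beta s t ->
  is_derive (heat_tau sigma rho s c0 c1 c2) t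
   ((c1 + 2 * c2 * s t)
    - heat_tau sigma rho s c0 c1 c2 t * (Derive (diffusion sigma) t / diffusion sigma t - 2 * q t)).
Proof.
  intros [PA PR DA _ _ Dr _ Ds]. unfold heat_tau. set (A := diffusion sigma) in *.
  auto_derive.
  - assert (0 < rho t ^ 2) by (apply pow_lt; exact PR).
    repeat split; try (eexists; eassumption). apply Rgt_not_eq, Rmult_lt_0_compat; simpl in *; lra.
  - derive_values. field. split; apply Rgt_not_eq; assumption.
Qed.

(** The terms are, in order: the derivative of xi^y over rho, using y_t = rho [drift] and s' = A
    rho^2; the effect of (1/rho)' = q/rho; and the product rule for [drift] times tau. *)
Lemma is_derive_heat_xi_t sigma p q rho beta s c0 c1 c2 g0 g1 t x :
  heat_derivatives sigma p q rho beta s t ->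
  is_derive (fun r => heat_xi sigma p q rho beta s c0 c1 c2 g0 g1 r x) t
   ((c2 * (diffusion sigma t * rho t ^ 2) * (rho t * x + beta t)
     + (c1 / 2 + c2 * s t) * (rho t * drift sigma p q t x) + g1 * (diffusion sigma t * rho t ^ 2)) / rho t
    + q t * (((c1 / 2 + c2 * s t) * (rho t * x + beta t) + (g0 + g1 * s t)) / rho t)
    - (Derive p t - Derive (diffusion sigma) t - x * Derive q t) * heat_tau sigma rho s c0 c1 c2 t
    - drift sigma p q t x * (c1 + 2 * c2 * s t
       - heat_tau sigma rho s c0 c1 c2 t * (Derive (diffusion sigma) t / diffusion sigma t - 2 * q t))).
Proof.
  intros HD. assert (Dt := is_derive_heat_tau _ _ _ _ _ _ c0 c1 c2 t HD).
  destruct HD as [PA PR DA Dp Dq Dr Db Ds]. unfold heat_xi, drift.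
  set (A := diffusion sigma) in *. set (T := heat_tau sigma rho s c0 c1 c2) in *.
  auto_derive.
  - repeat split; try (eexists; eassumption). apply Rgt_not_eq; assumption.
  - derive_values. field. split; apply Rgt_not_eq; assumption.
Qed.

Lemma is_derive_heat_xi_x sigma p q rho beta s c0 c1 c2 g0 g1 t x : rho t <> 0 ->
  is_derive (fun y => heat_xi sigma p q rho beta s c0 c1 c2 g0 g1 t y) x
    (c1 / 2 + c2 * s t + q t * heat_tau sigma rho s c0 c1 c2 t).
Proof.
  intros N. unfold heat_xi, drift. auto_derive; [exact Logic.I | field; exact N].
Qed.

Lemma is_derive_heat_f_t sigma p q rho beta s c1 c2 g1 z t x :
  heat_derivatives sigma p q rho beta s t ->
  is_derive (fun r => heat_f rho beta s c1 c2 g1 z r x) t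
   (- (c2 / 2) * (rho t * x + beta t) * (rho t * drift sigma p q t x)
    - g1 / 2 * (rho t * drift sigma p q t x) - c2 / 2 * (diffusion sigma t * rho t ^ 2)).
Proof.
  intros [PA PR DA Dp Dq Dr Db Ds]. unfold heat_f, drift.
  set (A := diffusion sigma) in *.
  auto_derive.
  - repeat split; try (eexists; eassumption).
  - derive_values. field.
Qed.

Lemma is_derive_heat_f_x rho beta s c1 c2 g1 z t x :
  is_derive (fun y => heat_f rho beta s c1 c2 g1 z t y) x
   (- (c2 / 2) * (rho t * x + beta t) * rho t - g1 / 2 * rho t).
Proof. unfold heat_f. auto_derive; [exact Logic.I | field]. Qed.

Lemma model_operator_heat_f sigma p q rho beta s c1 c2 g1 z t x :
  heat_derivatives sigma p q rho beta s t ->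
  model_operator sigma p q (heat_f rho beta s c1 c2 g1 z) t x = 0.
Proof.
  intros HD.
  assert (E1 : dt2 (heat_f rho beta s c1 c2 g1 z) t x = _)
    by exact (is_derive_unique _ _ _ (is_derive_heat_f_t _ _ _ _ _ _ c1 c2 g1 z t x HD)).
  assert (E2 : forall y, dx2 (heat_f rho beta s c1 c2 g1 z) t y = _)
    by exact (fun y => is_derive_unique _ _ _ (is_derive_heat_f_x rho beta s c1 c2 g1 z t y)).
  assert (E3 : dx2 (dx2 (heat_f rho beta s c1 c2 g1 z)) t x = - (c2 / 2) * rho t ^ 2).
  { refine (eq_trans (Derive_ext _ _ x E2) _).
    apply is_derive_unique; auto_derive; [exact Logic.I | ring]. }
  unfold model_operator. rewrite E1, E2, E3. field.
Qed.

Lemma heat_affine_determining (I : R -> Prop) sigma p q rho beta s c0 c1 c2 g0 g1 z g :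
  heat_coordinates I sigma p q rho beta s ->
  (forall t x, I t -> model_operator sigma p q g t x = 0) ->
  affine_determining I sigma p q (heat_tau sigma rho s c0 c1 c2)
    (heat_xi sigma p q rho beta s c0 c1 c2 g0 g1) (heat_f rho beta s c1 c2 g1 z) g.
Proof.
  intros H Hg t x It.
  assert (HD := heat_coordinates_derivatives _ _ _ _ _ _ _ t H It).
  assert (PA := hd_A _ _ _ _ _ _ _ HD). assert (PR := hd_rho _ _ _ _ _ _ _ HD).
  assert (NR : rho t <> 0) by (apply Rgt_not_eq; assumption).
  assert (E1 := is_derive_unique _ _ _ (is_derive_heat_tau _ _ _ _ _ _ c0 c1 c2 t HD)).
  assert (E2 : dt2 (heat_xi sigma p q rho beta s c0 c1 c2 g0 g1) t x = _)
    by exact (is_derive_unique _ _ _ (is_derive_heat_xi_t _ _ _ _ _ _ c0 c1 c2 g0 g1 t x HD)).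
  assert (E3 : forall y, dx2 (heat_xi sigma p q rho beta s c0 c1 c2 g0 g1) t y = _)
    by exact (fun y => is_derive_unique _ _ _ (is_derive_heat_xi_x sigma p q rho beta s c0 c1 c2 g0 g1 t y NR)).
  assert (E4 : dx2 (heat_f rho beta s c1 c2 g1 z) t x = _)
    by exact (is_derive_unique _ _ _ (is_derive_heat_f_x rho beta s c1 c2 g1 z t x)).
  assert (E5 : dx2 (dx2 (heat_xi sigma p q rho beta s c0 c1 c2 g0 g1)) t x = 0).
  { exact (eq_trans (Derive_ext _ _ x E3) (Derive_const _ _)). }
  split; [|split; [|split]].
  - rewrite E1, E3. field. apply Rgt_not_eq; assumption.
  - rewrite E1, E2, E3, E4, E5. unfold heat_xi. field. split; [apply Rgt_not_eq|]; assumption.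
  - apply model_operator_heat_f with (beta := beta); assumption.
  - apply Hg; exact It.
Qed.

Lemma smooth_heat_tau (I : R -> Prop) sigma p q rho beta s c0 c1 c2 :
  heat_coordinates I sigma p q rho beta s -> smooth_time I (heat_tau sigma rho s c0 c1 c2).
Proof.
  intros [HI Ss Sp Sq Sr Sb S PA PR _ _ _].
  assert (SA := smooth_diffusion I sigma HI Ss).
  unfold heat_tau. smooth.
  intros t _ _ It. apply Rgt_not_eq, Rmult_lt_0_compat; [|apply pow_lt]; auto.
Qed.

Lemma smooth_heat_y (I : R -> Prop) sigma p q rho beta s :
  heat_coordinates I sigma p q rho beta s -> smooth3 I (fun t x _ => rho t * x + beta t).
Proof. intros []; smooth. Qed.

Lemma smooth_heat_xi (I : R -> Prop) sigma p q rho beta s c0 c1 c2 g0 g1 :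
  heat_coordinates I sigma p q rho beta s ->
  smooth_slab I (heat_xi sigma p q rho beta s c0 c1 c2 g0 g1).
Proof.
  intros H. assert (Sy := smooth_heat_y _ _ _ _ _ _ _ H). assert (ST := smooth_heat_tau _ _ _ _ _ _ _ c0 c1 c2 H).
  destruct H as [HI Ss Sp Sq Sr Sb S PA PR _ _ _].
  assert (SA := smooth_diffusion I sigma HI Ss).
  apply (smooth2_of_smooth3 I (fun t x _ => heat_xi sigma p q rho beta s c0 c1 c2 g0 g1 t x) 0).
  unfold heat_xi, drift. smooth.
  intros t _ _ It. exact (Rgt_not_eq _ _ (PR t It)).
Qed.

Lemma smooth_heat_f (I : R -> Prop) sigma p q rho beta s c1 c2 g1 z :
  heat_coordinates I sigma p q rho beta s ->
  smooth_slab I (heat_f rho beta s c1 c2 g1 z).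
Proof.
  intros H. assert (Sy := smooth_heat_y _ _ _ _ _ _ _ H).
  destruct H as [HI Ss Sp Sq Sr Sb S PA PR _ _ _].
  apply (smooth2_of_smooth3 I (fun t x _ => heat_f rho beta s c1 c2 g1 z t x) 0).
  unfold heat_f. smooth. intros; lra.
Qed.

(** * Integration of the determining equations *)

Lemma is_derive_constant_interval (a b : Rbar) (f g g' : R -> R) :
  (forall t, interval a b t -> is_derive f t (g' t)) ->
  (forall t, interval a b t -> is_derive g t (g' t)) ->
  exists c, forall t, interval a b t -> f t = g t + c.
Proof.
  intros Hf Hg. destruct (is_derive_zero_interval a b (fun t => f t - g t)) as [c Hc].
  - intros t It. assert (Df := Hf t It). assert (Dg := Hg t It).
    auto_derive; [repeat split; eexists; eassumption|]. derive_values; ring.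
  - exists c; intros t It; specialize (Hc t It); lra.
Qed.

(* [M] and [G] are the coefficients of [xi^y = M y + G]; the determining equations say that [tau],
   [M], [G] and [f] solve ordinary differential equations in the new time [s]. *)
Lemma affine_determining_solved (a b : Rbar) sigma p q rho beta s tau xi f g :
  heat_coordinates (interval a b) sigma p q rho beta s ->
  smooth_time (interval a b) tau -> smooth_slab (interval a b) xi -> smooth_slab (interval a b) f ->
  affine_determining (interval a b) sigma p q tau xi f g ->
  exists c0 c1 c2 g0 g1 z, forall t x, interval a b t ->
    tau t = heat_tau sigma rho s c0 c1 c2 t /\
    xi t x = heat_xi sigma p q rho beta s c0 c1 c2 g0 g1 t x /\
    f t x = heat_f rho beta s c1 c2 g1 z t x.
Proof.
  set (I := interval a b). intros H St Sx Sf HD.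
  assert (HC := H).
  destruct HC as [HI Ss Sp Sq Sr Sb S PA PR Dr Db Ds].
  assert (SA := smooth_diffusion I sigma HI Ss).
  set (A := diffusion sigma) in *.
  pose (m := fun t => dx2 xi t 0). pose (n := fun t => xi t 0).
  assert (Sm : smooth_time I m).
  { apply (smooth_time_restrict I (fun t x _ => dx2 xi t x) 0 0 HI).
    apply smooth3_of_smooth2; [exact HI|]. apply smooth2_dx2; exact Sx. }
  assert (Sn : smooth_time I n).
  { apply (smooth_time_restrict I (fun t x _ => xi t x) 0 0 HI).
    apply smooth3_of_smooth2; [exact HI|exact Sx]. }
  (* The first determining equation expresses xi_x through tau and A alone, so it does not depend on
     x. *)
  assert (Ex : forall t x, I t -> dx2 xi t x = m t).
  { intros t x It. unfold m. destruct (HD t x It) as [E1 _]. destruct (HD t 0 It) as [E0 _].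
    fold A in E1, E0. assert (N := PA t It).
    apply (Rmult_eq_reg_l (2 * A t)); lra. }
  assert (Exi : forall t x, I t -> xi t x = m t * x + n t).
  { intros t x It.
    assert (L := Derive_zero_constant (fun y => xi t y - m t * y)).
    cbv beta in L. unfold n.
    enough (xi t x - m t * x = xi t 0 - m t * 0) by lra.
    apply L. intros y. assert (D := smooth2_is_derive_x (fun t _ => I t) xi t y Sx It).
    rewrite (Ex t y It) in D.
    auto_derive; [repeat split; eexists; exact D|]. derive_values; ring. }
  (* These come from xi^y = rho (xi + [drift] tau) after replacing rho x by y - beta. *)
  pose (M := fun t => m t - q t * tau t).
  pose (G := fun t => rho t * (n t + (p t - A t) * tau t) - M t * beta t).
  assert (SM : smooth_time I M) by (unfold M; smooth).
  assert (SG : smooth_time I G) by (unfold G; smooth).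
  (* [P] and [Q] are the derivatives of [M] and [G] in the new time, since d/ds is d/dt divided by A
     rho^2. *)
  pose (P := fun t => Derive M t / (A t * rho t ^ 2)).
  pose (Q := fun t => Derive G t / (A t * rho t ^ 2)).
  assert (NA : forall t, I t -> A t <> 0) by (intros t It; exact (Rgt_not_eq _ _ (PA t It))).
  assert (NR : forall t, I t -> rho t <> 0) by (intros t It; exact (Rgt_not_eq _ _ (PR t It))).
  assert (NS : forall t, I t -> A t * rho t ^ 2 <> 0).
  { intros t It; apply Rmult_integral_contrapositive_currified; [|apply pow_nonzero]; auto. }
  assert (SP : smooth_time I P).
  { assert (SM' := smooth_time_Derive I M SM). unfold P; smooth. auto. }
  assert (SQ : smooth_time I Q).
  { assert (SG' := smooth_time_Derive I G SG). unfold Q; smooth. auto. }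
  assert (ex : forall (k : R -> R) t, smooth_time I k -> I t -> is_derive k t (Derive k t)).
  { intros k t Sk It; apply Derive_correct, (smooth_time_ex_derive I); assumption. }
  assert (Exit : forall t x, I t -> dt2 xi t x = Derive m t * x + Derive n t).
  { intros t x It. unfold dt2.
    rewrite (Derive_ext_loc _ (fun t => m t * x + n t)).
    - apply is_derive_unique. apply is_derive_linear_comb; apply ex; assumption.
    - apply (open1_ext_loc I _ _ t HI); auto. }
  assert (Exx : forall t x, I t -> dx2 (dx2 xi) t x = 0).
  { intros t x It. exact (eq_trans (Derive_ext _ _ x (fun y => Ex t y It)) (Derive_const _ _)). }
  (* The second determining equation in heat form: f_y = - (xi^y)_s / 2, multiplied by y_x = rho. *)
  assert (Efx : forall t x, I t -> dx2 f t x = - (rho t / 2) * (P t * (rho t * x + beta t) + Q t)).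
  { intros t x It. destruct (HD t x It) as [_ [E2 _]].
    fold A in E2. rewrite (Exi t x It), (Ex t x It), (Exit t x It), (Exx t x It) in E2.
    assert (D1 : Derive M t = Derive m t - (Derive q t * tau t + q t * Derive tau t)).
    { assert (D1 := ex m t Sm It). assert (D2 := ex q t Sq It). assert (D3 := ex tau t St It).
      apply is_derive_unique. unfold M. auto_derive; [repeat split; eexists; eassumption|].
      derive_values; ring. }
    assert (D2 : Derive G t = - q t * rho t * (n t + (p t - A t) * tau t)
      + rho t * (Derive n t + (Derive p t - Derive A t) * tau t + (p t - A t) * Derive tau t)
      - Derive M t * beta t - M t * ((p t - A t) * rho t)).
    { assert (D2 := ex n t Sn It). assert (D3 := ex tau t St It). assert (D4 := ex M t SM It).
      assert (D5 := Dr t It). assert (D6 := Db t It). assert (D7 := ex p t Sp It). assert (D8 := ex A t SA It).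
      apply is_derive_unique. unfold G. auto_derive; [repeat split; eexists; eassumption|].
      derive_values; ring. }
    unfold P, Q. rewrite D2, D1. unfold M.
    apply (Rmult_eq_reg_l (2 * A t)); [|apply Rmult_integral_contrapositive_currified; [lra|auto]].
    unfold drift in E2; fold A in E2.
    (* Subtracting the vanishing left side cancels 2 A f_x, leaving an identity free of f. *)
    match type of E2 with ?lhs = 0 => transitivity (2 * A t * dx2 f t x - lhs); [rewrite E2; ring|] end.
    field. split; auto. }
  (* Since x = 0 corresponds to y = beta, the two corrections move the value of f there to the value
     at y = 0. *)
  pose (h := fun t => f t 0 + P t * beta t ^ 2 / 4 + Q t * beta t / 2).
  assert (Sh : smooth_time I h).
  { assert (Sf0 : smooth_time I (fun t => f t 0)).
    { apply (smooth_time_restrict I (fun t x _ => f t x) 0 0 HI), smooth3_of_smooth2; assumption. }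
    unfold h; smooth; intros; lra. }
  assert (Ef : forall t x, I t -> f t x =
    - P t / 4 * (rho t * x + beta t) ^ 2 - Q t / 2 * (rho t * x + beta t) + h t).
  { intros t x It.
    assert (L := Derive_zero_constant (fun x => f t x + P t / 4 * (rho t * x + beta t) ^ 2 + Q t / 2 * (rho t * x + beta t))).
    cbv beta in L.
    assert (L' := fun HH => L HH x 0). unfold h.
    match type of L' with _ -> ?l = ?r => enough (l = r) by lra end.
    apply L'. intros y. assert (D := smooth2_is_derive_x (fun t _ => I t) f t y Sf It).
    rewrite (Efx t y It) in D.
    auto_derive; [repeat split; eexists; exact D|]. derive_values; field. }
  assert (ODE : forall t, I t -> Derive P t = 0 /\ Derive Q t = 0 /\ Derive h t = - (A t * rho t ^ 2) * P t / 2).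
  { intros t It.
    assert (E : forall x, Derive P t / 4 * (rho t * x + beta t) ^ 2 + Derive Q t / 2 * (rho t * x + beta t)
       - Derive h t - A t * rho t ^ 2 * P t / 2 = 0).
    { intros x. destruct (HD t x It) as [_ [_ [E _]]].
      assert (E1 : dt2 f t x = - Derive P t / 4 * (rho t * x + beta t) ^ 2
         - P t / 2 * (rho t * x + beta t) * (rho t * drift sigma p q t x)
         - Derive Q t / 2 * (rho t * x + beta t) - Q t / 2 * (rho t * drift sigma p q t x) + Derive h t).
      { unfold dt2.
        rewrite (Derive_ext_loc _ (fun t => - P t / 4 * (rho t * x + beta t) ^ 2 - Q t / 2 * (rho t * x + beta t) + h t)).
        - assert (D1 := ex P t SP It). assert (D2 := ex Q t SQ It). assert (D3 := ex h t Sh It).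
          assert (D5 := Dr t It). assert (D6 := Db t It).
          apply is_derive_unique. auto_derive; [repeat split; eexists; eassumption|].
          derive_values. unfold drift; fold A. field.
        - apply (open1_ext_loc I _ _ t HI); auto. }
      assert (E2 : dx2 (dx2 f) t x = - (rho t ^ 2 / 2) * P t).
      { refine (eq_trans (Derive_ext _ _ x (fun y => Efx t y It)) _).
        apply is_derive_unique. auto_derive; [exact Logic.I|]. field. }
      unfold model_operator in E. rewrite E1, E2, (Efx t x It) in E. fold A in E.
      rewrite <- E. field. }
    (* [E] is a polynomial of degree 2 in y; the chosen x make y equal to 0, 1 and -1. *)
    assert (E0 := E (- beta t / rho t)). assert (E1 := E ((1 - beta t) / rho t)). assert (E2 := E ((-1 - beta t) / rho t)).
    replace (rho t * (- beta t / rho t) + beta t) with 0 in E0 by (field; auto).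
    replace (rho t * ((1 - beta t) / rho t) + beta t) with 1 in E1 by (field; auto).
    replace (rho t * ((-1 - beta t) / rho t) + beta t) with (-1) in E2 by (field; auto).
    repeat split; lra. }
  destruct (is_derive_zero_interval a b P) as [c2 HP].
  { intros t It. rewrite <- (proj1 (ODE t It)); apply ex; assumption. }
  destruct (is_derive_zero_interval a b Q) as [g1 HQ].
  { intros t It. rewrite <- (proj1 (proj2 (ODE t It))); apply ex; assumption. }
  destruct (is_derive_constant_interval a b M (fun t => c2 * s t) (fun t => c2 * (A t * rho t ^ 2))) as [c1' HM].
  { intros t It. rewrite <- (HP t It). replace (P t * (A t * rho t ^ 2)) with (Derive M t);
      [apply ex; assumption | unfold P; field; split; auto]. }
  { intros t It. assert (D := Ds t It). auto_derive; [eexists; exact D|]. derive_values; ring. }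
  destruct (is_derive_constant_interval a b G (fun t => g1 * s t) (fun t => g1 * (A t * rho t ^ 2))) as [g0 HG].
  { intros t It. rewrite <- (HQ t It). replace (Q t * (A t * rho t ^ 2)) with (Derive G t);
      [apply ex; assumption | unfold Q; field; split; auto]. }
  { intros t It. assert (D := Ds t It). auto_derive; [eexists; exact D|]. derive_values; ring. }
  (* Here tau A rho^2 is xi^s, and the first determining equation says that its derivative in s is 2
     [M]. *)
  destruct (is_derive_constant_interval a b (fun t => tau t * (A t * rho t ^ 2)) (fun t => c2 * s t ^ 2 + 2 * c1' * s t)
     (fun t => 2 * (A t * rho t ^ 2) * M t)) as [c0 HT].
  { intros t It. assert (D := ex tau t St It). assert (D2 := ex A t SA It). assert (D3 := Dr t It).
    auto_derive; [repeat split; eexists; eassumption|]. derive_values.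
    destruct (HD t 0 It) as [E1 _]. fold A in E1. rewrite (Ex t 0 It) in E1.
    unfold M.
    replace (m t) with ((tau t * Derive A t + A t * Derive tau t) / (2 * A t)) by (rewrite E1; field; auto).
    field. auto. }
  { intros t It. assert (D := Ds t It). auto_derive; [repeat split; eexists; exact D|]. derive_values.
    rewrite (HM t It); ring. }
  destruct (is_derive_constant_interval a b h (fun t => - c2 * s t / 2) (fun t => - (A t * rho t ^ 2) * c2 / 2)) as [z' Hh].
  { intros t It. rewrite <- (HP t It). rewrite <- (proj2 (proj2 (ODE t It))). apply ex; assumption. }
  { intros t It. assert (D := Ds t It). auto_derive; [eexists; exact D|]. derive_values; field. }
  (* As [M] is half of (xi^s)', its constant c1' is c1 / 2; the shift of z' offsets the term - c1 /
     4 in [heat_f]. *)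
  exists c0, (2 * c1'), c2, g0, g1, (z' + c1' / 2).
  intros t x It.
  assert (ET : tau t = heat_tau sigma rho s c0 (2 * c1') c2 t).
  { unfold heat_tau; fold A. replace (c0 + 2 * c1' * s t + c2 * s t ^ 2) with (tau t * (A t * rho t ^ 2)) by (rewrite (HT t It); ring).
    field; split; auto. }
  split; [exact ET|split].
  - unfold heat_xi. rewrite <- ET, (Exi t x It).
    replace (2 * c1' / 2 + c2 * s t) with (M t) by (rewrite (HM t It); field).
    replace (g0 + g1 * s t) with (G t) by (rewrite (HG t It); ring).
    unfold G, drift; fold A. unfold M. field; auto.
  - rewrite (Ef t x It), (HP t It), (HQ t It), (Hh t It). unfold heat_f. field.
Qed.

(** * The symmetry algebra *)

Definition heat_field (sigma p q rho beta s : R -> R) (c0 c1 c2 g0 g1 z : R) : vfield :=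
  affine_field (heat_tau sigma rho s c0 c1 c2) (heat_xi sigma p q rho beta s c0 c1 c2 g0 g1)
    (heat_f rho beta s c1 c2 g1 z) (fun _ _ => 0).

(** In heat coordinates P is d_y, Q is -2 s d_y + y F d_F and Z is F d_F, so that [P, Q] = Z. The
    coordinates a, b, c of [sl2] multiply -2 s d_s - y d_y + (F / 2) d_F, then - d_s / 2, then 2 s^2
    d_s + 2 s y d_y - (y^2 / 2 + s) F d_F. These scalings make the action on P and Q the defining
    representation. *)
Definition heat_algebra (sigma p q rho beta s : R -> R) (g : sl2W3) : vfield :=
  let '((a, b, c), (u, v, z)) := g in
  heat_field sigma p q rho beta s (- b / 2) (- 2 * a) (2 * c) u (- 2 * v) z.

Lemma heat_algebra_linear I sigma p q rho beta s (k : R) (g h : sl2W3) :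
  heat_coordinates I sigma p q rho beta s ->
  vf_eq I (heat_algebra sigma p q rho beta s (plus (scal k g) h))
    (vf_add (vf_scal k (heat_algebra sigma p q rho beta s g)) (heat_algebra sigma p q rho beta s h)).
Proof.
  intros H t x F It.
  assert (HD := heat_coordinates_derivatives _ _ _ _ _ _ _ t H It).
  assert (NA := Rgt_not_eq _ _ (hd_A _ _ _ _ _ _ _ HD)). assert (NR := Rgt_not_eq _ _ (hd_rho _ _ _ _ _ _ _ HD)).
  destruct g as [[[a b] c] [[u v] z]]. destruct h as [[[a' b'] c'] [[u' v'] z']].
  cbn.
  unfold scal, plus; cbn. unfold mult; cbn.
  unfold heat_xi, heat_tau, heat_f. split; [|split]; field; auto.
Qed.

Lemma affine_bracket_xi_t tau xi f tau' xi' f' t x F d d' :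
  is_derive tau t d -> is_derive tau' t d' ->
  xi_t (vf_bracket (affine_field tau xi f (fun _ _ => 0)) (affine_field tau' xi' f' (fun _ _ => 0))) t x F
  = tau t * d' - tau' t * d.
Proof.
  intros D D'. cbn. unfold vf_app, dt3, dx3, dF3; cbn. rewrite !Derive_const.
  derive_values. ring.
Qed.

Lemma affine_bracket_xi_x tau xi f tau' xi' f' t x F dt dx dt' dx' :
  is_derive (fun r => xi r x) t dt -> is_derive (fun y => xi t y) x dx ->
  is_derive (fun r => xi' r x) t dt' -> is_derive (fun y => xi' t y) x dx' ->
  xi_x (vf_bracket (affine_field tau xi f (fun _ _ => 0)) (affine_field tau' xi' f' (fun _ _ => 0))) t x F
  = tau t * dt' + xi t x * dx' - (tau' t * dt + xi' t x * dx).
Proof.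
  intros Dt Dx Dt' Dx'. cbn. unfold vf_app, dt3, dx3, dF3; cbn. rewrite !Derive_const.
  derive_values. ring.
Qed.

Lemma affine_bracket_eta tau xi f tau' xi' f' t x F dt dx dt' dx' :
  is_derive (fun r => f r x) t dt -> is_derive (fun y => f t y) x dx ->
  is_derive (fun r => f' r x) t dt' -> is_derive (fun y => f' t y) x dx' ->
  eta (vf_bracket (affine_field tau xi f (fun _ _ => 0)) (affine_field tau' xi' f' (fun _ _ => 0))) t x F
  = (tau t * dt' + xi t x * dx' - (tau' t * dt + xi' t x * dx)) * F.
Proof.
  intros Dt Dx Dt' Dx'. cbn. unfold vf_app, dt3, dx3, dF3; cbn.
  assert (L : forall h x d, is_derive h x d -> is_derive (fun r => h r * F + 0) x (d * F)).
  { intros h y d D. auto_derive; [repeat split; eexists; exact D|]. derive_values; ring. }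
  assert (L' : forall k, is_derive (fun v => k * v + 0) F k).
  { intros k. auto_derive; [exact Logic.I|ring]. }
  apply L in Dt, Dx, Dt', Dx'. assert (DF := L' (f t x)). assert (DF' := L' (f' t x)).
  derive_values. ring.
Qed.

(** Once the known derivatives are substituted, each component is a rational identity in the values
    at [t] of the coefficients, their derivatives and [rho], [beta], [s], with only A and rho in
    denominators. *)
Lemma heat_algebra_bracket I sigma p q rho beta s (g h : sl2W3) :
  heat_coordinates I sigma p q rho beta s ->
  vf_eq I (heat_algebra sigma p q rho beta s (sl2W3_bracket g h))
    (vf_bracket (heat_algebra sigma p q rho beta s g) (heat_algebra sigma p q rho beta s h)).
Proof.
  intros H t x F It.
  assert (HD := heat_coordinates_derivatives _ _ _ _ _ _ _ t H It).
  assert (NA := Rgt_not_eq _ _ (hd_A _ _ _ _ _ _ _ HD)). assert (NR := Rgt_not_eq _ _ (hd_rho _ _ _ _ _ _ _ HD)).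
  destruct g as [[[a b] c] [[u v] z]]. destruct h as [[[a' b'] c'] [[u' v'] z']].
  (* Each of the three components mentions [heat_algebra] three times; the first occurrence, the
     image of [sl2W3_bracket g h], stays folded. *)
  unfold heat_algebra at 2 3 5 6 8 9. unfold heat_field.
  rewrite (affine_bracket_xi_t _ _ _ _ _ _ t x F _ _ (is_derive_heat_tau _ _ _ _ _ _ _ _ _ t HD)
     (is_derive_heat_tau _ _ _ _ _ _ _ _ _ t HD)).
  rewrite (affine_bracket_xi_x _ _ _ _ _ _ t x F _ _ _ _
     (is_derive_heat_xi_t _ _ _ _ _ _ _ _ _ _ _ t x HD) (is_derive_heat_xi_x sigma p q rho beta s _ _ _ _ _ t x NR)
     (is_derive_heat_xi_t _ _ _ _ _ _ _ _ _ _ _ t x HD) (is_derive_heat_xi_x sigma p q rho beta s _ _ _ _ _ t x NR)).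
  rewrite (affine_bracket_eta _ _ _ _ _ _ t x F _ _ _ _
     (is_derive_heat_f_t _ _ _ _ _ _ _ _ _ _ t x HD) (is_derive_heat_f_x rho beta s _ _ _ _ t x)
     (is_derive_heat_f_t _ _ _ _ _ _ _ _ _ _ t x HD) (is_derive_heat_f_x rho beta s _ _ _ _ t x)).
  clear HD. cbn. unfold minus, plus, opp; cbn.
  split; [|split].
  - unfold heat_tau. field. auto.
  - unfold heat_xi, heat_tau. field. auto.
  - unfold heat_f, heat_xi, heat_tau. field. auto.
Qed.

Lemma is_derive_vanishing (I : R -> Prop) (f : R -> R) t l : open1 I -> I t ->
  (forall r, I r -> f r = 0) -> is_derive f t l -> l = 0.
Proof.
  intros HI It Hf D. rewrite <- (is_derive_unique _ _ _ D).
  rewrite (Derive_ext_loc f (fun _ => 0)); [apply Derive_const|].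
  apply (open1_ext_loc I _ _ t HI); auto.
Qed.

(** Differentiate in t and divide by s' = A rho^2, which never vanishes on [I]; doing so twice
    isolates [c2], then [c1], then [c0]. *)
Lemma quadratic_in_s_zero I sigma p q rho beta s c0 c1 c2 t0 :
  heat_coordinates I sigma p q rho beta s -> I t0 ->
  (forall t, I t -> c0 + c1 * s t + c2 * s t ^ 2 = 0) -> c0 = 0 /\ c1 = 0 /\ c2 = 0.
Proof.
  intros [HI _ _ _ _ _ _ PA PR _ _ Ds] It0 E.
  assert (N : forall t, I t -> diffusion sigma t * rho t ^ 2 <> 0).
  { intros t It; apply Rgt_not_eq, Rmult_lt_0_compat; [|apply pow_lt]; auto. }
  assert (E1 : forall t, I t -> c1 + 2 * c2 * s t = 0).
  { intros t It. apply (Rmult_eq_reg_r (diffusion sigma t * rho t ^ 2)); [|auto].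
    rewrite Rmult_0_l. apply (is_derive_vanishing I _ t _ HI It E).
    assert (D := Ds t It). auto_derive; [repeat split; eexists; exact D|]. derive_values; ring. }
  assert (E2 : 2 * c2 = 0).
  { apply (Rmult_eq_reg_r (diffusion sigma t0 * rho t0 ^ 2)); [|auto].
    rewrite Rmult_0_l. apply (is_derive_vanishing I _ t0 _ HI It0 E1).
    assert (D := Ds t0 It0). auto_derive; [repeat split; eexists; exact D|]. derive_values; ring. }
  assert (c2 = 0) by lra. subst c2.
  assert (F1 := E1 t0 It0). assert (c1 = 0) by lra. subst c1.
  assert (F0 := E t0 It0). repeat split; lra.
Qed.

(** The tau component kills the sl2 part and the x component kills [u] and [v]. For [z], one side is
    linear in F and the other free of F, so comparing F = 0 with F = 1 suffices. *)
Lemma heat_algebra_injective I sigma p q rho beta s g b t0 :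
  heat_coordinates I sigma p q rho beta s -> I t0 ->
  vf_eq I (heat_algebra sigma p q rho beta s g) (solution_field b) -> g = zero.
Proof.
  intros H It0 E.
  destruct g as [[[a' b'] c'] [[u v] z]].
  cbn in E.
  assert (N : forall t, I t -> diffusion sigma t * rho t ^ 2 <> 0).
  { intros t It; apply Rgt_not_eq, Rmult_lt_0_compat; [|apply pow_lt]; apply H; auto. }
  destruct (quadratic_in_s_zero I sigma p q rho beta s (- b' / 2) (- 2 * a') (2 * c') t0 H It0) as [E0 [E1 E2]].
  { intros t It. destruct (E t 0 0 It) as [E1 _]. unfold heat_tau in E1.
    apply (Rmult_eq_reg_r (/ (diffusion sigma t * rho t ^ 2))); [rewrite Rmult_0_l; exact E1|].
    apply Rinv_neq_0_compat; auto. }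
  (* With the sl2 part gone, rho times xi reduces to u - 2 v s. *)
  destruct (quadratic_in_s_zero I sigma p q rho beta s u (- 2 * v) 0 t0 H It0) as [E3 [E4 _]].
  { intros t It. destruct (E t 0 0 It) as [E5 [E6 _]]. cbn in E5, E6. unfold heat_xi in E6. rewrite E5, E1, E2 in E6.
    assert (NR := Rgt_not_eq _ _ (hc_rho_pos _ _ _ _ _ _ _ H t It)).
    apply (Rmult_eq_reg_r (/ rho t)); [|apply Rinv_neq_0_compat; exact NR].
    transitivity 0; [|ring]. etransitivity; [|exact E6]. field. exact NR. }
  destruct (E t0 0 0 It0) as [_ [_ E5]]. destruct (E t0 0 1 It0) as [_ [_ E6]].
  cbn in E5, E6. rewrite E1, E2, E4 in E5, E6. unfold heat_f in E5, E6.
  replace a' with 0 by lra. replace b' with 0 by lra. replace c' with 0 by lra.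
  replace u with 0 by lra. replace v with 0 by lra. replace z with 0 by lra.
  reflexivity.
Qed.

Lemma heat_algebra_affine I sigma p q rho beta s a b' c u v z b :
  vf_eq I (affine_field (heat_tau sigma rho s (- b' / 2) (- 2 * a) (2 * c))
      (heat_xi sigma p q rho beta s (- b' / 2) (- 2 * a) (2 * c) u (- 2 * v))
      (heat_f rho beta s (- 2 * a) (2 * c) (- 2 * v) z) b)
    (vf_add (heat_algebra sigma p q rho beta s (((a, b'), c), ((u, v), z))) (solution_field b)).
Proof. intros t x F It; cbn; repeat split; ring. Qed.

Lemma vf_eq_sym (I : R -> Prop) X Y : vf_eq I X Y -> vf_eq I Y X.
Proof. intros E t x F It; destruct (E t x F It) as [E1 [E2 E3]]; repeat split; symmetry; assumption. Qed.

Lemma vf_eq_trans (I : R -> Prop) X Y Z : vf_eq I X Y -> vf_eq I Y Z -> vf_eq I X Z.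
Proof.
  intros E E' t x F It; destruct (E t x F It) as [E1 [E2 E3]]; destruct (E' t x F It) as [E4 [E5 E6]].
  rewrite E1, E2, E3; auto.
Qed.

Lemma symmetries_of_model (a b : Rbar) sigma p q rho beta s X :
  heat_coordinates (interval a b) sigma p q rho beta s ->
  lie_symmetry (interval a b) (one_factor_model sigma p q) X <->
  exists (g : sl2W3) (w : R -> R -> R),
    solution (interval a b) (one_factor_model sigma p q) w /\
    vf_eq (interval a b) X (vf_add (heat_algebra sigma p q rho beta s g) (solution_field w)).
Proof.
  intros H. assert (HC := H). destruct HC as [HI Ss Sp Sq _ _ _ PA _ _ _ _].
  split.
  - intros HX.
    destruct (symmetry_affine _ sigma p q X HI Ss Sp Sq PA HX) as [tau [xi [f [g [St [Sx [Sf [Sg [E HD]]]]]]]]].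
    destruct (affine_determining_solved _ _ _ _ _ _ _ _ _ _ _ g H St Sx Sf HD)
      as [c0 [c1 [c2 [g0 [g1 [z Hz]]]]]].
    (* Inverse of the linear change of parameters in [heat_algebra]. *)
    exists (((- c1 / 2, - 2 * c0), c2 / 2), ((g0, - g1 / 2), z)), g.
    split.
    + split; [exact Sg|]. apply solves_model; intros t x It; apply (HD t x It).
    + apply (vf_eq_trans _ _ _ _ E).
      intros t x F It; destruct (Hz t x It) as [E1 [E2 E3]]. cbn.
      rewrite E1, E2, E3.
      replace (- (-2 * c0) / 2) with c0 by field. replace (- 2 * (- c1 / 2)) with c1 by field.
      replace (2 * (c2 / 2)) with c2 by field. replace (- 2 * (- g1 / 2)) with g1 by field.
      repeat split; ring.
  - intros [g [w [[Sw Hw] E]]].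
    destruct g as [[[a' b'] c'] [[u v] z]].
    apply (lie_symmetry_ext _ _ _ _ X _ HI Ss Sp Sq (vf_eq_trans _ _ _ _ E (vf_eq_sym _ _ _ (heat_algebra_affine _ _ _ _ _ _ _ _ _ _ _ _ _ _)))).
    apply (affine_symmetry (interval a b)); try assumption.
    + apply (smooth_heat_tau _ _ _ _ _ _ _ _ _ _ H).
    + apply (smooth_heat_xi _ _ _ _ _ _ _ _ _ _ _ _ H).
    + apply (smooth_heat_f _ _ _ _ _ _ _ _ _ _ _ H).
    + apply heat_affine_determining; [exact H|]. apply solves_model; exact Hw.
Qed.

(** * The ideal of solution fields *)

Lemma dt2_dx2_comm (I : R -> Prop) f t x : open1 I -> smooth_slab I f -> I t ->
  dt2 (dx2 f) t x = dx2 (dt2 f) t x.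
Proof.
  intros HI S It. apply Schwarz.
  - destruct (HI t It) as [eps He]. exists eps; intros u v Hu _.
    assert (Iu : I u) by (apply He; exact Hu).
    refine (conj _ (conj _ (conj _ _))).
    + exact (ex_intro _ _ (smooth2_is_derive_t _ _ u v S Iu)).
    + exact (ex_intro _ _ (smooth2_is_derive_x _ _ u v S Iu)).
    + exact (ex_intro _ _ (smooth2_is_derive_t _ _ u v (smooth2_dx2 _ _ S) Iu)).
    + exact (ex_intro _ _ (smooth2_is_derive_x _ _ u v (smooth2_dt2 _ _ S) Iu)).
  - exact (proj1 (smooth2_dt2 _ _ (smooth2_dx2 _ _ S) 0%nat) t x It).
  - exact (proj1 (smooth2_dx2 _ _ (smooth2_dt2 _ _ S) 0%nat) t x It).
Qed.

(* The component along [d/dF] of [[X, b d/dF]] for [X = tau d/dt + xi d/dx + (f F + g) d/dF]. *)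
Definition evolve (tau : R -> R) (xi f b : R -> R -> R) (t x : R) : R :=
  tau t * dt2 b t x + xi t x * dx2 b t x - f t x * b t x.

(** Applying the model operator to the evolved function and removing time derivatives of [b] by the
    equation leaves a combination of b_xx, b_x and b whose coefficients are, up to sign, the first
    three determining expressions. *)
Lemma solution_evolve (I : R -> Prop) (sigma p q : R -> R) tau xi f g b : open1 I ->
  smooth_time I sigma -> smooth_time I p -> smooth_time I q ->
  smooth_time I tau -> smooth_slab I xi -> smooth_slab I f ->
  affine_determining I sigma p q tau xi f g ->
  solution I (one_factor_model sigma p q) b ->
  solution I (one_factor_model sigma p q) (evolve tau xi f b).
Proof.
  intros HI Ss Sp Sq St Sx Sf HD [Sb Hb].
  assert (Hb' := proj1 (solves_model I sigma p q b) Hb).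
  assert (SA := smooth_diffusion I sigma HI Ss).
  assert (Sbx := smooth2_dx2 _ _ Sb). assert (Sbt := smooth2_dt2 _ _ Sb).
  assert (Sbxx := smooth2_dx2 _ _ Sbx).
  split.
  - apply (smooth2_of_smooth3 I (fun t x _ => evolve tau xi f b t x) 0). unfold evolve.
    apply smooth3_of_smooth2 in Sx, Sf, Sb, Sbx, Sbt; try assumption. smooth.
  - apply solves_model. intros t x It.
    assert (R0 : forall t x, I t -> dt2 b t x = diffusion sigma t * dx2 (dx2 b) t x + drift sigma p q t x * dx2 b t x).
    { intros r y Ir. generalize (Hb' r y Ir); unfold model_operator; lra. }
    set (U := fun t (_ : R) => I t) in *.
    assert (dx : forall k y, smooth2 U k -> is_derive (fun y => k t y) y (dx2 k t y))
      by (intros k y Sk; exact (smooth2_is_derive_x U k t y Sk It)).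
    assert (dt : forall k, smooth2 U k -> is_derive (fun r => k r x) t (dt2 k t x))
      by (intros k Sk; exact (smooth2_is_derive_t U k t x Sk It)).
    assert (ex : forall (k : R -> R), smooth_time I k -> is_derive k t (Derive k t)).
    { intros k Sk; apply Derive_correct, (smooth_time_ex_derive I); assumption. }
    (* [R2] and [R1] are the equation for [b] differentiated in x and in t; they eliminate b_tx and
       b_tt. *)
    assert (R2 : dx2 (dt2 b) t x = diffusion sigma t * dx2 (dx2 (dx2 b)) t x
       - q t * dx2 b t x + drift sigma p q t x * dx2 (dx2 b) t x).
    { refine (eq_trans (Derive_ext _ _ x (fun y => R0 t y It)) _).
      assert (D1 := dx _ x Sbx). assert (D2 := dx _ x Sbxx).
      apply is_derive_unique. unfold drift. auto_derive; [repeat split; eexists; eassumption|].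
      derive_values. ring. }
    assert (R1 : dt2 (dt2 b) t x = Derive (diffusion sigma) t * dx2 (dx2 b) t x
       + diffusion sigma t * dx2 (dx2 (dt2 b)) t x
       + (Derive p t - Derive (diffusion sigma) t - x * Derive q t) * dx2 b t x
       + drift sigma p q t x * dx2 (dt2 b) t x).
    { replace (dx2 (dx2 (dt2 b)) t x) with (dt2 (dx2 (dx2 b)) t x).
      2: { rewrite (dt2_dx2_comm I) by assumption.
           apply Derive_ext; intros y; apply (dt2_dx2_comm I); assumption. }
      rewrite <- (dt2_dx2_comm I b) by assumption.
      unfold dt2 at 1.
      rewrite (Derive_ext_loc _ (fun t => diffusion sigma t * dx2 (dx2 b) t x + drift sigma p q t x * dx2 b t x))
        by (apply (open1_ext_loc I _ _ t HI); auto).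
      assert (D1 := dt _ Sbx). assert (D2 := dt _ Sbxx).
      assert (D3 := ex _ SA). assert (D4 := ex _ Sp). assert (D5 := ex _ Sq).
      apply is_derive_unique. unfold drift. set (A := diffusion sigma) in *.
      auto_derive; [repeat split; eexists; eassumption|].
      derive_values. ring. }
    assert (E1 : dt2 (evolve tau xi f b) t x =
      Derive tau t * dt2 b t x + tau t * dt2 (dt2 b) t x + dt2 xi t x * dx2 b t x
      + xi t x * dx2 (dt2 b) t x - dt2 f t x * b t x - f t x * dt2 b t x).
    { rewrite <- (dt2_dx2_comm I b) by assumption.
      assert (D1 := ex _ St). assert (D2 := dt _ Sbt). assert (D3 := dt _ Sbx). assert (D4 := dt _ Sb).
      assert (D5 := dt _ Sx). assert (D6 := dt _ Sf).
      apply is_derive_unique. unfold evolve. auto_derive; [repeat split; eexists; eassumption|].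
      derive_values. ring. }
    assert (E2 : forall y, dx2 (evolve tau xi f b) t y =
      tau t * dx2 (dt2 b) t y + dx2 xi t y * dx2 b t y + xi t y * dx2 (dx2 b) t y
      - dx2 f t y * b t y - f t y * dx2 b t y).
    { intros y.
      assert (D2 := dx _ y Sbt). assert (D3 := dx _ y Sbx). assert (D4 := dx _ y Sb).
      assert (D5 := dx _ y Sx). assert (D6 := dx _ y Sf).
      apply is_derive_unique. unfold evolve. auto_derive; [repeat split; eexists; eassumption|].
      derive_values. ring. }
    assert (E3 : dx2 (dx2 (evolve tau xi f b)) t x =
      tau t * dx2 (dx2 (dt2 b)) t x + dx2 (dx2 xi) t x * dx2 b t x + 2 * dx2 xi t x * dx2 (dx2 b) t x
      + xi t x * dx2 (dx2 (dx2 b)) t x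
      - dx2 (dx2 f) t x * b t x - 2 * dx2 f t x * dx2 b t x - f t x * dx2 (dx2 b) t x).
    { refine (eq_trans (Derive_ext _ _ x E2) _).
      assert (D2 := dx _ x (smooth2_dx2 _ _ Sbt)). assert (D3 := dx _ x Sbx). assert (D4 := dx _ x Sb).
      assert (D5 := dx _ x Sx). assert (D6 := dx _ x Sf). assert (D7 := dx _ x Sbxx).
      assert (D8 := dx _ x (smooth2_dx2 _ _ Sx)). assert (D9 := dx _ x (smooth2_dx2 _ _ Sf)).
      apply is_derive_unique. auto_derive; [repeat split; eexists; eassumption|].
      derive_values. ring. }
    destruct (HD t x It) as [D1 [D2 [D3 _]]].
    unfold model_operator in *. rewrite E1, E2, E3, R1, (R0 t x It), R2.
    assert (C : forall k1 k2 k3 e1 e2 e3 : R, e1 = 0 -> e2 = 0 -> e3 = 0 -> k1 * e1 + k2 * e2 + k3 * e3 = 0)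
      by (intros; subst; ring).
    rewrite <- (C (- dx2 (dx2 b) t x) (- dx2 b t x) (- b t x) _ _ _ (Rminus_diag_eq _ _ D1) D2 D3).
    ring.
Qed.

(** A solution field points along F, so the bracket differentiates [X] only in F, and such
    derivatives are determined by the values of [X] on a line inside the slab. *)
Lemma bracket_solution_field (I : R -> Prop) X tau xi f g b t x F :
  vf_eq I X (affine_field tau xi f g) -> I t ->
  xi_t (vf_bracket X (solution_field b)) t x F = 0 /\
  xi_x (vf_bracket X (solution_field b)) t x F = 0 /\
  eta (vf_bracket X (solution_field b)) t x F = evolve tau xi f b t x.
Proof.
  intros E It.
  assert (E1 := dF3_ext I (xi_t X) (fun t _ _ => tau t) (fun t x F It => proj1 (E t x F It)) t x F It).
  assert (E2 := dF3_ext I (xi_x X) (fun t x _ => xi t x) (fun t x F It => proj1 (proj2 (E t x F It))) t x F It).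
  assert (E3 := dF3_ext I (eta X) (fun t x F => f t x * F + g t x) (fun t x F It => proj2 (proj2 (E t x F It))) t x F It).
  assert (D : dF3 (fun t x F => f t x * F + g t x) t x F = f t x).
  { apply is_derive_unique; auto_derive; [exact Logic.I|ring]. }
  rewrite D in E3.
  replace (dF3 (fun t _ _ => tau t) t x F) with 0 in E1 by (symmetry; exact (Derive_const _ _)).
  replace (dF3 (fun t x _ => xi t x) t x F) with 0 in E2 by (symmetry; exact (Derive_const _ _)).
  destruct (E t x F It) as [X1 [X2 _]]. cbn in X1, X2.
  cbn. unfold vf_app; cbn. rewrite E1, E2, E3, X1, X2.
  replace (dF3 (fun t x _ => b t x) t x F) with 0 by (symmetry; exact (Derive_const _ _)).
  replace (dt3 (fun _ _ _ => 0) t x F) with 0 by (symmetry; exact (Derive_const _ _)).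
  replace (dx3 (fun _ _ _ => 0) t x F) with 0 by (symmetry; exact (Derive_const _ _)).
  replace (dF3 (fun _ _ _ => 0) t x F) with 0 by (symmetry; exact (Derive_const _ _)).
  change (dt3 (fun t x _ => b t x) t x F) with (dt2 b t x).
  change (dx3 (fun t x _ => b t x) t x F) with (dx2 b t x).
  unfold evolve; repeat split; ring.
Qed.

Lemma bracket_solution_fields (I : R -> Prop) b b' :
  vf_eq I (vf_bracket (solution_field b) (solution_field b')) vf_zero.
Proof.
  intros t x F It. cbn. unfold vf_app; cbn.
  unfold dF3; rewrite !Derive_const. repeat split; ring.
Qed.

(** * Infinitely many independent solutions *)

Lemma sum_n_head (a : nat -> R) n : sum_n a (S n) = a 0%nat + sum_n (fun i => a (S i)) n.
Proof.
  induction n as [|n IH].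
  - rewrite sum_Sn, !sum_O. reflexivity.
  - rewrite sum_Sn, IH, (sum_Sn (fun i => a (S i)) n). unfold plus; simpl. ring.
Qed.

Lemma sum_n_pow_bounded (c : nat -> R) n :
  exists K, 0 <= K /\ forall Y, 0 < Y <= 1 -> Rabs (sum_n (fun i => c i * Y ^ i) n) <= K.
Proof.
  induction n as [|n [K [K0 HK]]].
  - exists (Rabs (c 0%nat)); split; [apply Rabs_pos|].
    intros Y _; rewrite sum_O; simpl. rewrite Rmult_1_r; apply Rle_refl.
  - exists (K + Rabs (c (S n))); split; [generalize (Rabs_pos (c (S n))); lra|].
    intros Y HY. rewrite sum_Sn. unfold plus; cbn [AbelianMonoid.plus].
    eapply Rle_trans; [apply Rabs_triang|]. apply Rplus_le_compat; [apply HK; exact HY|].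
    rewrite Rabs_mult. rewrite <- (Rmult_1_r (Rabs (c (S n)))) at 2.
    apply Rmult_le_compat_l; [apply Rabs_pos|].
    rewrite Rabs_pos_eq by (apply pow_le; lra).
    rewrite <- (pow1 (S n)). apply pow_incr; lra.
Qed.

(** The variable stands for exp y and is only known to be positive, so the constant coefficient
    cannot be read off at 0. It is bounded instead by Y times a constant for small Y; then one
    factor Y is divided out. *)
Lemma polynomial_zero_coefficients n : forall c : nat -> R,
  (forall Y, 0 < Y -> sum_n (fun i => c i * Y ^ i) n = 0) -> forall i, (i <= n)%nat -> c i = 0.
Proof.
  induction n as [|n IH]; intros c Hc.
  - intros i Hi. replace i with 0%nat by lia.
    generalize (Hc 1 Rlt_0_1); rewrite sum_O; simpl; lra.
  - assert (E : forall Y, 0 < Y -> c 0%nat + Y * sum_n (fun i => c (S i) * Y ^ i) n = 0).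
    { intros Y HY. rewrite <- (Hc Y HY), sum_n_head. simpl. f_equal; [ring|].
      rewrite <- (sum_n_mult_l (K := R_Ring)). apply sum_n_ext; intros i; unfold mult; simpl; ring. }
    destruct (sum_n_pow_bounded (fun i => c (S i)) n) as [K [K0 HK]].
    assert (C0 : c 0%nat = 0).
    { destruct (Req_dec (c 0%nat) 0) as [|N]; [assumption|exfalso].
      assert (P := Rabs_pos_lt _ N).
      set (k := Rabs (c 0%nat)) in *.
      (* At this Y the relation would give k <= k K / (k + K + 1), which is less than k. *)
      assert (HY : 0 < k / (k + K + 1) <= 1).
      { split; [apply Rdiv_lt_0_compat; lra|]. apply Rmult_le_reg_r with (k + K + 1); [lra|].
        unfold Rdiv; rewrite Rmult_assoc, Rinv_l by lra. lra. }
      assert (B : k <= k / (k + K + 1) * K).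
      { unfold k at 1. replace (c 0%nat) with (- (k / (k + K + 1) * sum_n (fun i => c (S i) * (k / (k + K + 1)) ^ i) n))
          by (generalize (E _ (proj1 HY)); lra).
        rewrite Rabs_Ropp, Rabs_mult, (Rabs_pos_eq (k / (k + K + 1))) by lra.
        apply Rmult_le_compat_l; [lra|]. apply HK; exact HY. }
      apply (Rmult_le_compat_r (k + K + 1)) in B; [|lra].
      replace (k / (k + K + 1) * K * (k + K + 1)) with (k * K) in B by (field; lra).
      nra. }
    assert (Z : forall i, (i <= n)%nat -> c (S i) = 0).
    { apply (IH (fun i => c (S i))). intros Y HY. generalize (E Y HY); rewrite C0; intros E'.
      apply (Rmult_eq_reg_l Y); lra. }
    intros [|i] Hi; [exact C0 | apply Z; lia].
Qed.

Lemma exp_INR_mult n y : exp (INR n * y) = exp y ^ n.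
Proof.
  induction n as [|n IH]; [simpl; rewrite Rmult_0_l; apply exp_0|].
  rewrite S_INR, Rmult_plus_distr_r, Rmult_1_l, exp_plus, IH; simpl; ring.
Qed.

Definition exponential_solution (rho beta s : R -> R) (k t x : R) : R :=
  exp (k * (rho t * x + beta t) + k ^ 2 * s t).

Lemma exponential_solution_solves I sigma p q rho beta s k :
  heat_coordinates I sigma p q rho beta s ->
  solution I (one_factor_model sigma p q) (exponential_solution rho beta s k).
Proof.
  intros H. split.
  - apply (smooth2_of_smooth3 I (fun t x _ => exponential_solution rho beta s k t x) 0).
    assert (Sy := smooth_heat_y _ _ _ _ _ _ _ H). destruct H. unfold exponential_solution. smooth.
  - apply solves_model. intros t x It.
    assert (HD := heat_coordinates_derivatives _ _ _ _ _ _ _ t H It).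
    destruct HD as [PA PR DA Dp Dq Dr Db Ds].
    assert (Et : dt2 (exponential_solution rho beta s k) t x =
      (k * (rho t * drift sigma p q t x) + k ^ 2 * (diffusion sigma t * rho t ^ 2)) * exponential_solution rho beta s k t x).
    { apply is_derive_unique. unfold exponential_solution, drift. set (A := diffusion sigma) in *.
      auto_derive; [repeat split; eexists; eassumption|].
      derive_values.
      match goal with |- context [exp ?u] => set (e := exp u) end.
      replace (exp (k * (rho t * x + beta t) + k ^ 2 * s t)) with e by (unfold e; f_equal; ring). ring. }
    assert (Ex : forall y, dx2 (exponential_solution rho beta s k) t y = (k * rho t) * exponential_solution rho beta s k t y).
    { intros y. apply is_derive_unique. unfold exponential_solution.
      auto_derive; [exact Logic.I|].
      match goal with |- context [exp ?u] => set (e := exp u) end.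
      replace (exp (k * (rho t * y + beta t) + k ^ 2 * s t)) with e by (unfold e; f_equal; ring). ring. }
    assert (Exx : dx2 (dx2 (exponential_solution rho beta s k)) t x = (k * rho t) ^ 2 * exponential_solution rho beta s k t x).
    { refine (eq_trans (Derive_ext _ _ x Ex) _).
      transitivity (k * rho t * dx2 (exponential_solution rho beta s k) t x); [apply Derive_scal|].
      rewrite Ex; ring. }
    unfold model_operator. rewrite Et, Ex, Exx. ring.
Qed.

(** At a fixed time y runs over all reals with x, since rho is nonzero there. A linear relation
    between the exponentials becomes a polynomial relation in Y = exp y > 0, and the factors exp
    (k^2 s) do not vanish. *)
Lemma model_infinite_dimensional I sigma p q rho beta s t0 :
  heat_coordinates I sigma p q rho beta s -> I t0 ->
  infinite_dimensional_solutions I (one_factor_model sigma p q).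
Proof.
  intros H It0 n. exists (fun i => exponential_solution rho beta s (INR i)).
  split; [intros i _; apply exponential_solution_solves; exact H|].
  intros c Hc.
  assert (Z : forall i, (i <= n)%nat -> c i * exp (INR i ^ 2 * s t0) = 0).
  { apply (polynomial_zero_coefficients n (fun i => c i * exp (INR i ^ 2 * s t0))).
    intros Y HY. rewrite <- (Hc t0 ((ln Y - beta t0) / rho t0) It0).
    apply sum_n_ext; intros i. unfold exponential_solution.
    replace (rho t0 * ((ln Y - beta t0) / rho t0) + beta t0) with (ln Y)
      by (field; apply Rgt_not_eq; apply H; exact It0).
    rewrite exp_plus, exp_INR_mult, exp_ln by exact HY.
    match goal with |- ?l = ?r => change (@eq R l r) end. ring. }
  intros i Hi. destruct (Rmult_integral _ _ (Z i Hi)) as [|N]; [assumption|].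
  generalize (exp_pos (INR i ^ 2 * s t0)); lra.
Qed.

Lemma model_maximally_symmetric (a b : Rbar) sigma p q rho beta s : Rbar_lt a b ->
  heat_coordinates (interval a b) sigma p q rho beta s ->
  maximally_symmetric (interval a b) (one_factor_model sigma p q).
Proof.
  intros Hab H. destruct (interval_inhabited a b Hab) as [t0 It0].
  exists (heat_algebra sigma p q rho beta s).
  split; [intros; apply (heat_algebra_linear _ _ _ _ _ _ _ _ _ _ H)|].
  split; [intros; apply (heat_algebra_bracket _ _ _ _ _ _ _ _ _ H)|].
  split.
  { intros t x F It; cbn. unfold heat_xi, heat_tau, heat_f, Rdiv. repeat split; ring. }
  split; [intros X; apply symmetries_of_model; exact H|].
  split; [intros g w _ E; apply (heat_algebra_injective _ _ _ _ _ _ _ _ _ _ H It0 E)|].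
  split; [|split].
  - intros X w HX Hw.
    destruct H as [HI Ss Sp Sq _ _ _ PA _ _ _ _].
    destruct (symmetry_affine _ sigma p q X HI Ss Sp Sq PA HX) as [tau [xi [f [g [St [Sx [Sf [Sg [E HD]]]]]]]]].
    exists (evolve tau xi f w). split.
    + apply (solution_evolve _ _ _ _ tau xi f g); assumption.
    + intros t x F It. apply (bracket_solution_field _ _ _ _ _ _ _ _ _ _ E It).
  - intros; apply bracket_solution_fields.
  - apply (model_infinite_dimensional _ _ _ _ _ _ _ _ H It0).
Qed.

(** * Equivalence with the heat equation *)

Lemma interval_neighbours (a b : Rbar) t : interval a b t ->
  exists e, 0 < e /\ forall k, Rabs k <= e -> interval a b (t + k).
Proof.
  intros It. destruct (open1_interval a b t It) as [eps He].
  exists (eps / 2); split; [generalize (cond_pos eps); lra|].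
  intros k Hk; apply He. unfold ball; simpl; unfold AbsRing_ball, abs, minus, plus, opp; simpl.
  replace (t + k + - t) with k by ring. generalize (cond_pos eps); lra.
Qed.

Lemma positive_derivative_increasing (a b : Rbar) (s s' : R -> R) :
  (forall t, interval a b t -> is_derive s t (s' t)) ->
  (forall t, interval a b t -> 0 < s' t) ->
  forall t1 t2, interval a b t1 -> interval a b t2 -> t1 < t2 -> s t1 < s t2.
Proof.
  intros D P t1 t2 I1 I2 L.
  destruct (MVT_gen s t1 t2 s') as [c [Hc E]].
  - intros y Hy; apply D, (interval_between a b t1 t2); auto; lra.
  - intros y Hy; apply continuity_pt_filterlim.
    apply (ex_derive_continuous (V := R_NormedModule)); eexists; apply D, (interval_between a b t1 t2); auto.
  - assert (0 < s' c) by (apply P, (interval_between a b t1 t2); auto).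
    assert (0 < s' c * (t2 - t1)) by (apply Rmult_lt_0_compat; lra). lra.
Qed.

(** The target interval runs from the infimum to the supremum of the image; strict monotonicity
    shows that neither is attained, and the intermediate value theorem that everything between
    is. *)
Lemma interval_inverse_function (a b : Rbar) (s s' : R -> R) : Rbar_lt a b ->
  (forall t, interval a b t -> is_derive s t (s' t)) ->
  (forall t, interval a b t -> 0 < s' t) ->
  exists (c d : Rbar) (r : R -> R), Rbar_lt c d /\
    (forall t, interval a b t -> interval c d (s t) /\ r (s t) = t) /\
    (forall y, interval c d y -> interval a b (r y) /\ s (r y) = y /\ is_derive r y (/ s' (r y))).
Proof.
  intros Hab D P.
  assert (Inc := positive_derivative_increasing a b s s' D P).
  set (I := interval a b) in *.
  pose (Im := fun y => exists t, I t /\ y = s t).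
  pose (c := Glb_Rbar Im). pose (d := Lub_Rbar Im).
  (* For y = s t this set has the maximum t, so the supremum returns t; [real] makes the function
     total. *)
  pose (r := fun y => real (Lub_Rbar (fun t => I t /\ s t <= y))).
  assert (Hc : is_glb_Rbar Im c) by apply Glb_Rbar_correct.
  assert (Hd : is_lub_Rbar Im d) by apply Lub_Rbar_correct.
  assert (Inc' : forall t1 t2, I t1 -> I t2 -> s t1 <= s t2 -> t1 <= t2).
  { intros t1 t2 I1 I2 L. destruct (Rle_lt_dec t1 t2) as [|N]; [assumption|].
    generalize (Inc t2 t1 I2 I1 N); lra. }
  assert (In : forall t, I t -> interval c d (s t)).
  { intros t It. destruct (interval_neighbours a b t It) as [e [e0 He]].
    assert (I1 : I (t + - e)) by (apply He; rewrite Rabs_Ropp, Rabs_pos_eq; lra).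
    assert (I2 : I (t + e)) by (apply He; rewrite Rabs_pos_eq; lra).
    split.
    - apply Rbar_le_lt_trans with (s (t + - e)).
      + apply Hc; exists (t + - e); auto.
      + apply Inc; auto; lra.
    - apply Rbar_lt_le_trans with (s (t + e)).
      + apply Inc; auto; lra.
      + apply Hd; exists (t + e); auto. }
  assert (Rs : forall t, I t -> r (s t) = t).
  { intros t It. unfold r. rewrite (is_lub_Rbar_unique _ t); [reflexivity|].
    split.
    - intros t' [It' L]. apply Inc'; assumption.
    - intros u Hu. apply Hu. split; [exact It|apply Rle_refl]. }
  assert (Sur : forall y, interval c d y -> exists t, I t /\ s t = y).
  { intros y [Hcy Hyd].
    assert (exists t1, I t1 /\ s t1 < y) as [t1 [I1 L1]].
    { apply Classical_Prop.NNPP; intros N.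
      apply (Rbar_lt_not_le _ _ Hcy), Hc. intros v [t [It ->]]; simpl.
      destruct (Rle_lt_dec y (s t)) as [|L]; [assumption|]. elim N; exists t; auto. }
    assert (exists t2, I t2 /\ y < s t2) as [t2 [I2 L2]].
    { apply Classical_Prop.NNPP; intros N.
      apply (Rbar_lt_not_le _ _ Hyd), Hd. intros v [t [It ->]]; simpl.
      destruct (Rle_lt_dec (s t) y) as [|L]; [assumption|]. elim N; exists t; auto. }
    assert (L12 : t1 < t2).
    { destruct (Rle_lt_dec t2 t1) as [[L|E]|]; [|subst; lra|assumption].
      generalize (Inc _ _ I2 I1 L); lra. }
    destruct (Ranalysis5.IVT_interv (fun t => s t - y) t1 t2) as [t [Ht E]]; try lra.
    - intros t Ht. apply continuity_pt_minus; [|apply continuity_pt_const; intros ? ?; reflexivity].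
      apply continuity_pt_filterlim, (ex_derive_continuous (V := R_NormedModule)); eexists.
      apply D, (interval_between a b t1 t2); auto. rewrite Rmin_left, Rmax_right; lra.
    - exists t; split; [|lra].
      apply (interval_between a b t1 t2); auto. rewrite Rmin_left, Rmax_right; lra. }
  exists c, d, r. split; [|split; [intros t It; split; auto|]].
  { destruct (interval_inhabited a b Hab) as [t0 It0].
    apply Rbar_lt_trans with (s t0); apply (In t0 It0). }
  intros y Hy. destruct (Sur y Hy) as [t [It <-]].
  rewrite (Rs t It). split; [exact It|split; [reflexivity|]].
  apply is_derive_Reals. intros eps Heps.
  assert (P' := P t It).
  assert (Dt := D t It). apply is_derive_Reals in Dt.
  (* With Dq = h / k, the first bound keeps Dq above s'/2, so Dq s' exceeds s'^2 / 2; the second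
     then makes the difference of inverses, |Dq - s'| / (Dq s'), smaller than eps. *)
  pose (e' := Rmin (s' t / 2) (eps * (s' t * s' t) / 2)).
  assert (He' : 0 < e').
  { apply Rmin_pos; [lra|]. apply Rdiv_lt_0_compat; [|lra].
    repeat apply Rmult_lt_0_compat; assumption. }
  destruct (Dt e' He') as [d1 Hd1].
  destruct (interval_neighbours a b t It) as [e0 [He0 Hn]].
  pose (e := Rmin e0 (d1 / 2)).
  assert (He : 0 < e) by (apply Rmin_pos; [assumption|generalize (cond_pos d1); lra]).
  assert (Le0 : e <= e0) by apply Rmin_l. assert (Le1 : e <= d1 / 2) by apply Rmin_r.
  assert (I1 : I (t + - e)) by (apply Hn; rewrite Rabs_Ropp, Rabs_pos_eq; lra).
  assert (I2 : I (t + e)) by (apply Hn; rewrite Rabs_pos_eq; lra).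
  assert (L1 := Inc _ _ I1 It ltac:(lra)). assert (L2 := Inc _ _ It I2 ltac:(lra)).
  (* An increment h below this bound keeps s t + h between s (t - e) and s (t + e), so by
     monotonicity |k| <= e < d1. *)
  assert (Hdel : 0 < Rmin (s t - s (t + - e)) (s (t + e) - s t)) by (apply Rmin_pos; lra).
  exists (mkposreal _ Hdel). intros h Hh Hhd; simpl in Hhd.
  assert (M1 := Rmin_l (s t - s (t + - e)) (s (t + e) - s t)).
  assert (M2 := Rmin_r (s t - s (t + - e)) (s (t + e) - s t)).
  assert (Bh := Rabs_def2 _ _ Hhd).
  assert (Jh : interval c d (s t + h)).
  { split.
    - apply Rbar_lt_trans with (s (t + - e)); [apply (In _ I1)|simpl; lra].
    - apply Rbar_lt_trans with (s (t + e)); [simpl; lra|apply (In _ I2)]. }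
  destruct (Sur _ Jh) as [t' [It' Et']].
  rewrite <- Et', (Rs t' It'), (Rs t It).
  set (k := t' - t).
  assert (B1 : t' <= t + e) by (apply Inc'; auto; lra).
  assert (B2 : t + - e <= t') by (apply Inc'; auto; lra).
  assert (Hk0 : k <> 0).
  { intros E. apply Hh. replace t' with t in Et' by (unfold k in E; lra). lra. }
  assert (Hk : Rabs k < d1).
  { apply Rle_lt_trans with e; [apply Rabs_le; unfold k; lra|]. generalize (cond_pos d1); lra. }
  assert (Q := Hd1 k Hk0 Hk).
  replace (t + k) with t' in Q by (unfold k; ring). rewrite Et' in Q.
  replace (s t + h - s t) with h in Q by ring.
  assert (Q1 : e' <= s' t / 2) by apply Rmin_l.
  assert (Q2 : e' <= eps * (s' t * s' t) / 2) by apply Rmin_r.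
  assert (Q3 := Rabs_def2 _ _ Q).
  set (Dq := h / k) in *.
  assert (PD : s' t / 2 < Dq) by lra.
  replace (k / h) with (/ Dq) by (unfold Dq; field; split; assumption).
  replace (/ Dq - / s' t) with (- (Dq - s' t) * / (Dq * s' t)) by (field; lra).
  assert (PP : 0 < Dq * s' t) by (apply Rmult_lt_0_compat; lra).
  rewrite Rabs_mult, Rabs_Ropp, (Rabs_pos_eq (/ _)) by (apply Rlt_le, Rinv_0_lt_compat; exact PP).
  apply Rmult_lt_reg_r with (Dq * s' t); [exact PP|].
  rewrite Rmult_assoc, Rinv_l, Rmult_1_r by lra.
  apply Rlt_le_trans with (1 := Q), Rle_trans with (1 := Q2).
  replace (eps * (s' t * s' t) / 2) with (eps * (s' t / 2 * s' t)) by field.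
  apply Rmult_le_compat_l; [lra|]. apply Rmult_le_compat_r; lra.
Qed.

(** * Change of variables on open sets *)

Lemma open2_locally (U : R -> R -> Prop) t x : open2 U -> U t x ->
  locally ((t, x) : R * R) (fun p => U (fst p) (snd p)).
Proof. intros O H; exact (O (t, x) H). Qed.

Lemma open2_locally_t (U : R -> R -> Prop) t x : open2 U -> U t x -> locally t (fun r => U r x).
Proof.
  intros O H; destruct (open2_locally U t x O H) as [e He].
  exists e; intros r Hr; apply (He (r, x)). split; [exact Hr|apply ball_center].
Qed.

Lemma open2_locally_x (U : R -> R -> Prop) t x : open2 U -> U t x -> locally x (fun y => U t y).
Proof.
  intros O H; destruct (open2_locally U t x O H) as [e He].
  exists e; intros r Hr; apply (He (t, r)). split; [apply ball_center|exact Hr].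
Qed.

(** Both s and y vary with t, so the t-derivative of u (s, y) needs total differentiability. It
    follows from a t-partial that exists nearby and is continuous at the point, together with the
    x-partial there. *)
Lemma smooth2_differentiable (U : R -> R -> Prop) f t x : open2 U -> smooth2 U f -> U t x ->
  differentiable_pt_lim f t x (dt2 f t x) (dx2 f t x).
Proof.
  intros O S H. apply filterdiff_differentiable_pt_lim.
  apply (is_derive_filterdiff f t x (dt2 f) (dx2 f t x)).
  - generalize (open2_locally U t x O H); apply filter_imp; intros [r y] Hp.
    apply (smooth2_is_derive_t U); [exact S | exact Hp].
  - apply (smooth2_is_derive_x U); assumption.
  - apply (continuity_2d_pt_filterlim (dt2 f) t x).
    exact (proj1 (smooth2_dt2 _ _ S 0%nat) t x H).
Qed.

(** The factor [k] allows iteration: [k] = 1 gives f_x = rho u_y, and then [k] = [rho] gives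
    f_xx. *)
Lemma chain_rule_x (U V : R -> R -> Prop) (rho beta s : R -> R) k (f u : R -> R -> R) t x :
  open2 U -> smooth2 V u ->
  (forall t x, U t x -> V (s t) (rho t * x + beta t) /\ f t x = k t * u (s t) (rho t * x + beta t)) ->
  U t x -> dx2 f t x = k t * rho t * dx2 u (s t) (rho t * x + beta t).
Proof.
  intros O S E H. destruct (E t x H) as [HV _].
  unfold dx2 at 1. rewrite (Derive_ext_loc _ (fun y => k t * u (s t) (rho t * y + beta t))).
  - assert (D := smooth2_is_derive_x V u _ _ S HV).
    apply is_derive_unique.
    auto_derive; [repeat split; eexists; exact D|]. derive_values; ring.
  - generalize (open2_locally_x U t x O H); apply filter_imp; intros y Hy; apply E; exact Hy.
Qed.

(** The drift term rho [drift] u_y cancels against y_t u_y in F_t, so only s' = A rho^2 times (u_yy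
    - u_s) survives. *)
Lemma heat_chart_operator I sigma p q rho beta s (U V : R -> R -> Prop) f u t x :
  heat_coordinates I sigma p q rho beta s ->
  open2 U -> open2 V -> (forall t x, U t x -> I t) -> smooth2 U f -> smooth2 V u ->
  (forall t x, U t x -> V (s t) (rho t * x + beta t) /\ f t x = u (s t) (rho t * x + beta t)) ->
  U t x ->
  model_operator sigma p q f t x =
  diffusion sigma t * rho t ^ 2 * heat_equation (jet_of u (s t) (rho t * x + beta t)).
Proof.
  intros H OU OV UI Sf Su E Utx.
  assert (HD := heat_coordinates_derivatives _ _ _ _ _ _ _ t H (UI t x Utx)).
  destruct HD as [PA PR DA Dp Dq Dr Db Ds].
  assert (E1 : forall t x, U t x -> dx2 f t x = rho t * dx2 u (s t) (rho t * x + beta t)).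
  { intros r y Hry.
    rewrite (chain_rule_x U V rho beta s (fun _ => 1) f u r y OU Su); [ring| |exact Hry].
    intros t' x' H'; destruct (E t' x' H') as [E1 E2]; split; [exact E1|rewrite E2; ring]. }
  assert (E2 : dx2 (dx2 f) t x = rho t ^ 2 * dx2 (dx2 u) (s t) (rho t * x + beta t)).
  { rewrite (chain_rule_x U V rho beta s rho (dx2 f) (dx2 u) t x OU (smooth2_dx2 _ _ Su)); [ring| |assumption].
    intros r y Hry; split; [apply E; exact Hry|apply E1; exact Hry]. }
  assert (E3 : dt2 f t x = diffusion sigma t * rho t ^ 2 * dt2 u (s t) (rho t * x + beta t)
     + rho t * drift sigma p q t x * dx2 u (s t) (rho t * x + beta t)).
  { unfold dt2 at 1. rewrite (Derive_ext_loc _ (fun r => u (s r) (rho r * x + beta r))).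
    - apply is_derive_unique, is_derive_Reals.
      replace (diffusion sigma t * rho t ^ 2 * dt2 u (s t) (rho t * x + beta t)
     + rho t * drift sigma p q t x * dx2 u (s t) (rho t * x + beta t))
       with (dt2 u (s t) (rho t * x + beta t) * (diffusion sigma t * rho t ^ 2)
           + dx2 u (s t) (rho t * x + beta t) * (rho t * drift sigma p q t x)) by ring.
      apply (derivable_pt_lim_comp_2d u s (fun r => rho r * x + beta r)).
      + apply (smooth2_differentiable V); [assumption|assumption|apply E; exact Utx].
      + apply is_derive_Reals; exact Ds.
      + apply is_derive_Reals. auto_derive; [repeat split; eexists; eassumption|].
        derive_values. unfold drift; ring.
    - generalize (open2_locally_t U t x OU Utx); apply filter_imp; intros r Hr; apply E; exact Hr. }
  unfold model_operator. rewrite (E1 t x Utx), E2, E3.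
  unfold heat_equation; simpl. ring.
Qed.

Lemma model_point_equivalent (a b : Rbar) sigma p q rho beta s : Rbar_lt a b ->
  heat_coordinates (interval a b) sigma p q rho beta s ->
  point_equivalent_to_heat (interval a b) (one_factor_model sigma p q).
Proof.
  intros Hab H. assert (HC := H).
  destruct HC as [HI Ss Sp Sq Sr Sb S PA PR Dr Db Ds].
  assert (PS : forall t, interval a b t -> 0 < diffusion sigma t * rho t ^ 2).
  { intros t It; apply Rmult_lt_0_compat; [|apply pow_lt]; auto. }
  destruct (interval_inverse_function a b s _ Hab Ds PS) as [c [d [r [Hcd [Hs Hr]]]]].
  assert (HJ := open1_interval c d).
  assert (SA := smooth_diffusion _ _ HI Ss).
  assert (Sds : smooth_time (interval a b) (fun t => / (diffusion sigma t * rho t ^ 2))).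
  { apply (smooth3_inv (interval a b) (fun t _ _ => diffusion sigma t * rho t ^ 2) HI).
    - intros t _ _ It; exact (Rgt_not_eq _ _ (PS t It)).
    - smooth. }
  assert (Dinv : forall y, interval c d y -> is_derive r y (/ (diffusion sigma (r y) * rho (r y) ^ 2)))
    by (intros y Jy; apply Hr; exact Jy).
  assert (rI : forall y, interval c d y -> interval a b (r y)) by (intros y Jy; apply Hr; exact Jy).
  assert (Sinv : smooth_time (interval c d) r).
  (* Bootstrap on r' = 1 / (A rho^2) evaluated at r: a continuous right side starts the induction,
     and each order of [r] yields the next. *)
  { intros n; induction n as [|n IH].
    - apply Ck3_pred, (Ck3_time_S _ 0 r (fun y => / (diffusion sigma (r y) * rho (r y) ^ 2)) HJ Dinv).
      split; [|exact Logic.I]. intros y x F Jy.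
      apply (continuous_comp (fun p : R * R * R => fst (fst p)) (fun y => / (diffusion sigma (r y) * rho (r y) ^ 2))).
      + apply (continuous_comp (fun p : R * R * R => fst p) (fun z => fst z)); apply continuous_fst.
      + apply (continuous_comp r (fun t => / (diffusion sigma t * rho t ^ 2))).
        * apply (ex_derive_continuous (V := R_NormedModule)); eexists; apply Dinv; exact Jy.
        * apply (ex_derive_continuous (V := R_NormedModule)), (smooth_time_ex_derive (interval a b) _ _ Sds); auto.
    - apply (Ck3_time_S _ n r _ HJ Dinv).
      apply (Ck3_time_comp (interval a b) (interval c d) n (fun t => / (diffusion sigma t * rho t ^ 2)) r); assumption. }
  assert (Srr : smooth_time (interval c d) (fun y => rho (r y)))
    by (intros n; apply (Ck3_time_comp (interval a b)); auto).
  assert (Sbr : smooth_time (interval c d) (fun y => beta (r y)))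
    by (intros n; apply (Ck3_time_comp (interval a b)); auto).
  exists c, d,
    (fun w : R * R * R => (s (fst (fst w)), rho (fst (fst w)) * snd (fst w) + beta (fst (fst w)), snd w)),
    (fun w : R * R * R => (r (fst (fst w)), (snd (fst w) - beta (r (fst (fst w)))) / rho (r (fst (fst w))), snd w)).
  split; [exact Hcd|split].
  - split; [|split; [|split]].
    + refine (conj _ (conj _ _)).
      * exact S.
      * exact (smooth_heat_y _ _ _ _ _ _ _ H).
      * exact (smooth3_F _ HI).
    + refine (conj _ (conj _ _)).
      * exact Sinv.
      * assert (Sx := smooth3_x _ HJ).
        apply (smooth3_div (interval c d) (fun y z _ => z - beta (r y)) (fun y _ _ => rho (r y)) HJ).
        -- intros y _ _ Jy. exact (Rgt_not_eq _ _ (PR _ (rI y Jy))).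
        -- smooth.
        -- exact Srr.
      * exact (smooth3_F _ HJ).
    + intros [[t x] F] It; simpl in *. destruct (Hs t It) as [J E].
      split; [exact J|]. rewrite E. f_equal. f_equal. field. exact (Rgt_not_eq _ _ (PR t It)).
    + intros [[y z] F] Jy; simpl in *. destruct (Hr y Jy) as [It [E _]].
      split; [exact It|]. rewrite E. f_equal. f_equal. field. exact (Rgt_not_eq _ _ (PR _ It)).
  - intros U V f u OU UI OV VJ Sf Su [G1 G2].
    (* The transformation leaves F unchanged and sends (t, x) to (s, y) independently of F, so
       mapping one graph into the other means f (t, x) = u (s, y). *)
    assert (E : forall t x, U t x -> V (s t) (rho t * x + beta t) /\ f t x = u (s t) (rho t * x + beta t)).
    { intros t x Utx. destruct (G1 t x Utx) as [s' [y' [HV Heq]]]. simpl in Heq.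
      injection Heq as <- <- ->. split; [exact HV|reflexivity]. }
    assert (K : forall t x, U t x -> one_factor_model sigma p q (jet_of f t x) =
       diffusion sigma t * rho t ^ 2 * heat_equation (jet_of u (s t) (rho t * x + beta t))).
    { intros t x Utx. rewrite <- (heat_chart_operator _ _ _ _ _ _ _ U V f u t x H) by assumption.
      unfold one_factor_model, model_operator, drift, diffusion; simpl; ring. }
    split; intros Hsol.
    (* Every point of [V] is the image of a point of [U], and the positive factor s' can be
       cancelled there. *)
    + intros y z Vyz. destruct (G2 y z Vyz) as [t [x [Utx Heq]]]. simpl in Heq.
      injection Heq as <- <- _.
      apply (Rmult_eq_reg_l (diffusion sigma t * rho t ^ 2)).
      * rewrite <- K, Rmult_0_r by exact Utx. apply Hsol; exact Utx.
      * exact (Rgt_not_eq _ _ (PS t (UI t x Utx))).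
    + intros t x Utx. rewrite K by exact Utx. rewrite (Hsol (s t) (rho t * x + beta t)); [ring|].
      apply E; exact Utx.
Qed.

Theorem mainTheorem3 :
  forall (a b : Rbar) (sigma kappa mu lambda : R -> R),
    Rbar_lt a b ->
    smooth1 (interval a b) sigma ->
    smooth1 (interval a b) kappa ->
    smooth1 (interval a b) mu ->
    smooth1 (interval a b) lambda ->
    (forall t, interval a b t -> sigma t <> 0) ->
    let q := kappa in
    let p := fun t => kappa t * (mu t - lambda t) in
    maximally_symmetric (interval a b) (one_factor_model sigma p q) /\
    point_equivalent_to_heat (interval a b) (one_factor_model sigma p q).
Proof.
  intros a b sigma kappa mu lambda Hab Hs Hk Hm Hl Hnz q p.
  assert (HI := open1_interval a b).
  apply smooth1_time in Hs, Hk, Hm, Hl; try exact HI.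
  assert (Sp : smooth_time (interval a b) p) by (unfold p; smooth).
  destruct (heat_coordinates_exist a b sigma p q Hab Hs Sp Hk Hnz) as [rho [beta [s H]]].
  split.
  - exact (model_maximally_symmetric a b sigma p q rho beta s Hab H).
  - exact (model_point_equivalent a b sigma p q rho beta s Hab H).
Qed.
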